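(* Let $\ell\in(0,\infty)$ and let $f:(0,\ell)\to\mathbb{R}^n$ be a $C^2$ curve parametrized by the arc-length. Let $\kappa_1(s)=\|f''(s)\|$, $s\in(0,\ell)$, be the first curvature of $f$. Let $0<\delta<\infty$ be given. Consider the following conditions. (i) $f$ admits a $C^2$ parametrization $g:(0,1)\to\mathbb{R}^n$ such that $g'(x)\neq0$ for all $x\in(0,1)$ and $g''$ is bounded. (ii) $V_f^{\delta}:=\sup\{\sum_{k=1}^{m}\sqrt{\lambda(I_k)}\}<\infty$, the supremum being taken over all finite systems $(I_k)_{k=1}^m$ of pairwise non-overlapping compact subintervals of $(0,\ell)$ such that $\lambda(I_k)\max_{s\in I_k}\kappa_1(s)\ge\delta$ for $k=1,\dots,m$ (with $V_f^\delta=0$ if there are no such systems). (iii) $\int_0^{\ell}\sqrt{\kappa_1(s)}\,ds<\infty$. Then (i) and (ii) are equivalent, and (i) implies (iii). If $\kappa_1$ is monotone on some right neighbourhood of $0$ and on some left neighbourhood of $\ell$, then (i), (ii) and (iii) are pairwise equivalent.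
   Context: $\mathbb{R}^n$ carries the Euclidean norm $\|\cdot\|$; $\lambda$ is Lebesgue measure. Intervals are nondegenerate, and non-overlapping means having disjoint interiors. $f:(0,\ell)\to\mathbb{R}^n$ is parametrized by the arc-length if for all $0<u<v<\ell$ the variation of $f$ on $[u,v]$, i.e. $\sup\sum_i\|f(x_i)-f(x_{i-1})\|$ over partitions of $[u,v]$, equals $v-u$. A parametrization $g:(0,1)\to\mathbb{R}^n$ of $f$ is a map $g=f\circ h$ with $h:(0,1)\to(0,\ell)$ an increasing homeomorphism. *)

(* Defs.v *)
From HB Require Import structures.
From mathcomp Require Import all_boot all_order all_algebra.
From mathcomp Require Import all_classical all_reals all_analysis.

Set Implicit Arguments.
Unset Strict Implicit.
Unset Printing Implicit Defensive.

Import Order.TTheory GRing.Theory Num.Theory.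
Import numFieldNormedType.Exports.

Local Open Scope classical_set_scope.
Local Open Scope ring_scope.

(* Curves on an open interval `]a, b[ are total functions on R, of which only
   the values on `]a, b[ matter. *)

(* The library norm `|x| on 'rV[R]_n is the sup norm; it induces the same
   topology, hence the same continuity and derivatives, as the Euclidean one. *)
Definition enorm (R : realType) (n : nat) (x : 'rV[R]_n) : R :=
  Num.sqrt (\sum_(i < n) x 0 i ^+ 2).

(* Analogue of numfun.variation for the Euclidean norm. *)
Definition evariation (R : realType) (n : nat) (a b : R)
    (f : R -> 'rV[R]_n) (s : seq R) : R :=
  let F := f \o nth b (a :: s) in
  \sum_(0 <= k < size s) enorm (F k.+1 - F k).

Definition total_evariation (R : realType) (n : nat) (a b : R)
    (f : R -> 'rV[R]_n) : \bar R :=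
  ereal_sup [set (evariation a b f s)%:E | s in itv_partition a b].

Definition arc_length_parametrized (R : realType) (n : nat) (l : R)
    (f : R -> 'rV[R]_n) : Prop :=
  forall u v : R, 0 < u -> u < v -> v < l ->
    total_evariation u v f = (v - u)%:E.

Definition C2_on (R : realType) (n : nat) (a b : R)
    (f : R -> 'rV[R]_n) : Prop :=
  forall x : R, x \in `]a, b[ ->
    [/\ derivable f x 1, derivable f^`()%classic x 1 &
        {for x, continuous f^`(2)%classic}].

Definition homeomorphism_between (R : realType) (A B : set R)
    (h : R -> R) : Prop :=
  [/\ set_bij A B h, {within A, continuous h} &
    exists2 k : R -> R, {in A, cancel h k} & {within B, continuous k}].

Definition parametrization (R : realType) (n : nat) (l : R)
    (f g : R -> 'rV[R]_n) : Prop :=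
  exists h : R -> R,
    [/\ homeomorphism_between `]0, 1[ `]0, l[ h,
        {in `]0, 1[ &, {homo h : x y / x < y}} &
        {in `]0, 1[, g =1 f \o h}].

Definition curvature1 (R : realType) (n : nat) (f : R -> 'rV[R]_n)
    (s : R) : R := enorm (f^`(2)%classic s).

Definition has_bounded_C2_parametrization (R : realType) (n : nat) (l : R)
    (f : R -> 'rV[R]_n) : Prop :=
  exists g : R -> 'rV[R]_n,
    [/\ parametrization l f g, C2_on 0 1 g,
        (forall x : R, x \in `]0, 1[ -> g^`()%classic x != 0) &
        exists M : R, forall x : R, x \in `]0, 1[ -> enorm (g^`(2)%classic x) <= M].

Definition is_max (R : realType) (A : set R) (M : R) : Prop :=
  A M /\ ubound A M.

Definition leb_length (R : realType) (A : set R) : R :=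
  fine (lebesgue_measure A).

(* Systems I_k = [a_k, b_k], k < m, over which V_f^delta is a supremum. *)
Definition admissible_system (R : realType) (n : nat) (l : R)
    (f : R -> 'rV[R]_n) (delta : R) (m : nat) (a b : 'I_m -> R) : Prop :=
  [/\ forall k, a k < b k /\ (`[a k, b k] `<=` `]0%R, l[)%classic,
      trivIset setT (fun k => (`[a k, b k]°)%classic) &
      forall k, exists2 M : R, is_max (curvature1 f @` `[a k, b k]) M &
        delta <= leb_length `[a k, b k] * M].

(* The empty system (m = 0) is always admissible and contributes the sum 0,
   so that the value is 0 when there is no nonempty admissible system. *)
Definition Vdelta (R : realType) (n : nat) (l : R)
    (f : R -> 'rV[R]_n) (delta : R) : \bar R :=
  ereal_sup [set x : \bar R | exists (m : nat) (a b : 'I_m -> R),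
    admissible_system l f delta a b /\
    x = (\sum_(k < m) Num.sqrt (leb_length `[a k, b k]))%:E].

Definition monotone_on (R : realType) (A : set R) (k : R -> R) : Prop :=
  {in A &, nondecreasing_fun k} \/ {in A &, nonincreasing_fun k}.

Definition monotone_near_ends (R : realType) (l : R) (k : R -> R) : Prop :=
  (exists2 e : R, 0 < e <= l & monotone_on `]0, e[ k) /\
  (exists2 e : R, 0 <= e < l & monotone_on `]e, l[ k).

(* Main.v *)
Require Import Defs.
From HB Require Import structures.
From mathcomp Require Import all_boot all_order all_algebra.
From mathcomp Require Import all_classical all_reals all_analysis.
From mathcomp Require Import measurable_realfun ring lra.
Import Order.TTheory GRing.Theory Num.Theory.
Import numFieldNormedType.Exports.
Local Open Scope ring_scope.
Local Open Scope classical_set_scope.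

(* For a curve of unit speed, [g = f \o h] is a C^2 parametrization with [g'']
   bounded iff [h'] > 0 and both [h''] and [h'^2 kappa(h)] are bounded.
   - From such an [h], the bound [sqrt (kappa (h)) h' <= sqrt M] gives (iii). For
     (ii), on [[c, d] = h^-1 [a, b]] the speed is at most its value at the point
     of maximal curvature plus [M (d - c)], so that
     [(b - a) max kappa >= delta] forces [sqrt (b - a) <= C (d - c)].
   - Conversely, walk from the middle towards each end point of the curve in
     steps [s_k -> s_(k+1)] that are as long as
     [(s_(k+1) - s_k) max kappa <= delta] and [s_(k+1) <= (s_k + l) / 2] allow.
     Steps of the second kind contribute a telescoping sum to
     [sum_k sqrt (s_(k+1) - s_k)]; those of the first kind are controlled by
     (ii), or by (iii) if kappa is monotone near the ends. Then [h] maps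
     consecutive intervals of length [t_k = sqrt (s_(k+1) - s_k)] onto the steps
     by quintic polynomials with [h'' = 0] at the nodes, with [h' <= 3 t_k] and
     [|h''| <= 66]. *)

(** * Gluing polynomial pieces *)

(** The square roots come from scaling: crossing a step of length [L] with [h''] of order 1 and low
    speed at its ends takes a time of order [sqrt L] at a speed of order [sqrt L], and then
    [h'^2 kappa] is of order [L kappa], which the choice of the step keeps bounded. Hence the total
    time, which has to be finite, is the sum of the square roots. The midpoint cap is due to the
    ends: [kappa] is bounded only on compact subintervals of []0, l[], and without the cap a flat
    curve would reach [l] in one step. A quintic is what six end conditions ask for: value, speed
    and second derivative at both ends of a piece. Node sequences are built for the end [l] only;
    the end [0] follows by the reflection [y -> l - y], and the two halves share an affine germ in
    the middle. For (iii) to replace (ii), increasing curvature turns a saturated step into a lower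
    bound of [kappa] on the next one, while decreasing curvature is bounded near the end. In (i) the
    map [h] is only a homeomorphism; its smoothness comes from [h' = |g'|], a consequence of unit
    speed. *)

Lemma glue_continuous {R : realType} (c x : R) (g1 g2 : R -> R) :
  g1 c = g2 c -> (x <= c -> {for x, continuous g1}) ->
  (c <= x -> {for x, continuous g2}) ->
  {for x, continuous (fun y => if y <= c then g1 y else g2 y)}.
Proof.
move=> gc c1 c2; rewrite /prop_for /continuous_at.
case: (ltgtP x c) => xc.
- apply: cvg_trans (c1 (ltW xc)); apply: near_eq_cvg.
  by near=> y; rewrite ifT//; apply: ltW; near: y; exact: lt_nbhsl.
- apply: cvg_trans (c2 (ltW xc)); apply: near_eq_cvg.
  near=> y; rewrite ifF//; apply/negbTE; rewrite -ltNge.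
  by near: y; exact: lt_nbhsr.
- rewrite xc; rewrite xc in c1 c2.
  apply/cvgrPdist_lt => e e0.
  have /cvgrPdist_lt/(_ e e0) h1 := c1 (lexx c).
  have /cvgrPdist_lt/(_ e e0) h2 := c2 (lexx c).
  near=> y; case: ifPn => _; first by near: y.
  by rewrite gc; near: y.
Unshelve. all: by end_near. Qed.

(** By Caratheodory's criterion, differentiability at the joint is continuity of a slope function,
    so the two slope functions can be glued by [glue_continuous]. *)
Lemma glue_is_derive {R : realType} (c x : R) (g1 g2 d1 d2 : R -> R) :
  g1 c = g2 c -> d1 c = d2 c -> (x <= c -> is_derive x 1 g1 (d1 x)) ->
  (c <= x -> is_derive x 1 g2 (d2 x)) ->
  is_derive x 1 (fun y => if y <= c then g1 y else g2 y)
    (if x <= c then d1 x else d2 x).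
Proof.
move=> gc dc D1 D2; case: (ltgtP x c) => xc.
- apply: near_eq_is_derive (D1 (ltW xc)).
  by near=> y; rewrite ifT//; apply: ltW; near: y; exact: lt_nbhsl.
- apply: near_eq_is_derive (D2 (ltW xc)).
  near=> y; rewrite ifF//; apply/negbTE; rewrite -ltNge.
  by near: y; exact: lt_nbhsr.
- rewrite xc in D1 D2 *.
  have /is_derive1_caratheodory[G1 [E1 C1 V1]] := D1 (lexx c).
  have /is_derive1_caratheodory[G2 [E2 C2 V2]] := D2 (lexx c).
  apply/is_derive1_caratheodory.
  exists (fun y => if y <= c then G1 y else G2 y); split.
  + move=> z; rewrite lexx; case: ifPn => _; first exact: E1.
    by rewrite gc; exact: E2.
  + by apply: glue_continuous => //; rewrite V1 V2.
  + by rewrite lexx V1.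
Unshelve. all: by end_near. Qed.

Lemma is_derive_quintic {R : realType} (e A B C v : R) :
  is_derive v 1
    (fun w : R => e * w + A * w ^+ 3 + B * w ^+ 4 + C * w ^+ 5)
    (e + 3 * A * v ^+ 2 + 4 * B * v ^+ 3 + 5 * C * v ^+ 4).
Proof.
have -> : (fun w : R => e * w + A * w ^+ 3 + B * w ^+ 4 + C * w ^+ 5)
  = horner (e *: 'X + A *: 'X^3 + B *: 'X^4 + C *: 'X^5).
  by apply/funext => w; rewrite !hornerE.
apply: is_derive_eq.
by rewrite !(derivD, derivZ, derivXn, derivX, derivC) !(hornerE, hornerMn)/=; ring.
Qed.

Lemma is_derive_quartic {R : realType} (e A B C v : R) :
  is_derive v 1
    (fun w : R => e + A * w ^+ 2 + B * w ^+ 3 + C * w ^+ 4)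
    (2 * A * v + 3 * B * v ^+ 2 + 4 * C * v ^+ 3).
Proof.
have -> : (fun w : R => e + A * w ^+ 2 + B * w ^+ 3 + C * w ^+ 4)
  = horner (e%:P + A *: 'X^2 + B *: 'X^3 + C *: 'X^4).
  by apply/funext => w; rewrite !hornerE.
apply: is_derive_eq.
by rewrite !(derivD, derivZ, derivXn, derivX, derivC) !(hornerE, hornerMn)/=; ring.
Qed.

(** The components of [q] are position, speed and acceleration. A displacement [t ^+ 2] in time [t]
    means average speed [t]; since [e] and [e'] do not exceed it, the bump that supplies the missing
    displacement has a coefficient [c >= 0], which keeps the speed positive. *)
Lemma transition_piece {R : realType} (t e e' : R) :
  0 < t -> 0 < e <= t -> 0 < e' <= t ->
  exists q : (R -> R) * (R -> R) * (R -> R),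
  [/\ forall v : R, is_derive v 1 q.1.1 (q.1.2 v),
      forall v : R, is_derive v 1 q.1.2 (q.2 v),
      continuous q.2,
      [/\ q.1.1 0 = 0, q.1.2 0 = e & q.2 0 = 0] &
      [/\ q.1.1 t = t ^+ 2, q.1.2 t = e' & q.2 t = 0] /\
      (forall v, 0 <= v <= t -> 0 < q.1.2 v <= 3 * t /\ `|q.2 v| <= 66)].
Proof.
move=> t0 /andP[e0 et] /andP[e'0 e't].
(* With [u = v / t], the speed is the cubic step from [e] to [e'] plus the bump
   [30 c (u (1 - u))^2], where [c] makes its integral over [[0, t]] equal to
   [t^2]. *)
pose c := t - (e + e') / 2.
pose A := (e' - e + 10 * c) / t ^+ 2.
pose B := (- ((e' - e) / 2) - 15 * c) / t ^+ 3.
pose C := 6 * c / t ^+ 4.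
have tn0 : t != 0 by rewrite gt_eqF.
exists (fun w : R => e * w + A * w ^+ 3 + B * w ^+ 4 + C * w ^+ 5,
  fun v : R => e + 3 * A * v ^+ 2 + 4 * B * v ^+ 3 + 5 * C * v ^+ 4,
  fun v : R => 2 * (3 * A) * v + 3 * (4 * B) * v ^+ 2 + 4 * (5 * C) * v ^+ 3).
split => /=.
- by move=> v; exact: is_derive_quintic.
- by move=> v; exact: is_derive_quartic.
- have -> : (fun v : R => 2 * (3 * A) * v + 3 * (4 * B) * v ^+ 2 + 4 * (5 * C) * v ^+ 3)
    = horner ((2 * (3 * A)) *: 'X + (3 * (4 * B)) *: 'X^2 + (4 * (5 * C)) *: 'X^3).
    by apply/funext => w; rewrite !hornerE.
  exact: continuous_horner.
- by split; rewrite ?expr0n/=; ring.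
split; first by split; rewrite /A /B /C /c; field.
move=> v /andP[v0 vt].
pose u := v / t.
have u0 : 0 <= u by rewrite divr_ge0// ltW.
have u1 : u <= 1 by rewrite ler_pdivrMr// mul1r.
have c0 : 0 <= c by rewrite /c; lra.
have ct : c <= t by rewrite /c; lra.
have -> : e + 3 * A * v ^+ 2 + 4 * B * v ^+ 3 + 5 * C * v ^+ 4
  = e * ((1 - u) ^+ 2 * (1 + 2 * u)) + e' * (u ^+ 2 * (3 - 2 * u))
    + c * (30 * (u * (1 - u)) ^+ 2).
  by rewrite /A /B /C /u; field.
have -> : 2 * (3 * A) * v + 3 * (4 * B) * v ^+ 2 + 4 * (5 * C) * v ^+ 3
  = ((e' - e) / t) * (6 * (u * (1 - u)))
    + (c / t) * (60 * ((u * (1 - u)) * (1 - 2 * u))).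
  by rewrite /A /B /C /u; field.
have w0 : 0 <= u * (1 - u) by rewrite mulr_ge0// subr_ge0.
have w1 : u * (1 - u) <= 4^-1.
  by have := sqr_ge0 (u - 2^-1); rewrite -subr_ge0 => h; rewrite -subr_ge0; lra.
set w := u * (1 - u) in w0 w1 *.
have p0 : 0 <= (1 - u) ^+ 2 * (1 + 2 * u).
  by rewrite mulr_ge0 ?sqr_ge0//; lra.
have p1 : 0 <= u ^+ 2 * (3 - 2 * u).
  by rewrite mulr_ge0 ?sqr_ge0//; lra.
have pq : (1 - u) ^+ 2 * (1 + 2 * u) + u ^+ 2 * (3 - 2 * u) = 1 by ring.
set p := (1 - u) ^+ 2 * (1 + 2 * u) in p0 pq *.
set p' := u ^+ 2 * (3 - 2 * u) in p1 pq *.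
have ww : 0 <= w ^+ 2 <= 16^-1.
  by rewrite sqr_ge0/= (_ : 16^-1 = 4^-1 ^+ 2 :> R) ?ler_pXn2r ?nnegrE//; field.
move: (w ^+ 2) ww => W /andP[W0 W1].
have cW : 0 <= c * (30 * W) by rewrite !mulr_ge0.
split.
  have pos : 0 < e * p + e' * p'.
    have [p00|p00] := eqVneq p 0.
      have -> : p' = 1 by rewrite -pq p00 add0r.
      by rewrite p00 mulr0 mulr1 add0r.
    rewrite ltr_pwDl//.
      by rewrite mulr_gt0// lt_neqAle eq_sym p00 p0.
    by rewrite mulr_ge0// ltW.
  apply/andP; split; first by rewrite ltr_wpDr.
  have h1 : e * p <= t * p by rewrite ler_wpM2r.
  have h2 : e' * p' <= t * p' by rewrite ler_wpM2r.
  (* The bump is at most [2 t], as [c <= t] and [30 W <= 30 / 16]. The cubic part averages [e] and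
     [e'] with weights [p] and [p'], so it is at most [t]; together [3 t]. *)
  have h3 : c * (30 * W) <= t * 2.
    by rewrite ler_pM ?mulr_ge0//; lra.
  have h4 : t * p + t * p' = t by rewrite -mulrDr pq mulr1.
  lra.
have a1 : `|(e' - e) / t| <= 1.
  rewrite normrM normfV (gtr0_norm t0) ler_pdivrMr// mul1r ler_norml.
  by apply/andP; split; lra.
have a2 : `|c / t| <= 1.
  rewrite normrM normfV (gtr0_norm t0) ler_pdivrMr// mul1r ler_norml.
  by apply/andP; split; lra.
have a3 : `|6 * w| <= 6 by rewrite ler_norml; apply/andP; split; lra.
have a4 : `|60 * (w * (1 - 2 * u))| <= 60.
  have : `|w * (1 - 2 * u)| <= 1.
    rewrite normrM -[leRHS]mulr1 ler_pM//.
      by rewrite ler_norml; apply/andP; split; lra.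
    by rewrite ler_norml; apply/andP; split; lra.
  by rewrite !ler_norml => /andP[? ?]; apply/andP; split; lra.
rewrite (le_trans (ler_normD _ _))// !normrM.
move: a1 a2 a3 a4; rewrite !normrM => a1 a2 a3 a4.
have -> : (66 : R) = 1 * 6 + 1 * 60 by ring.
by rewrite lerD// ler_pM// ?mulr_ge0.
Qed.

(** The last piece continues to the right of its own interval, so a finite gluing is as regular on
    the whole line as its pieces. *)
Fixpoint pieces {R : realType} (x : nat -> R) (p : R -> R) (q : nat -> R -> R)
    (N : nat) : R -> R :=
  if N is M.+1 then fun z => if z <= x M then pieces x p q M z else q M z
  else p.

(** Finite gluings agree with all longer ones up to [x N] ([pieces_stable]), so any node beyond [z]
    yields the same value. When there is none, [xget] defaults to index [0]; the lemmas below
    evaluate to the left of some node. *)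
Definition glued {R : realType} (x : nat -> R) (p : R -> R)
    (q : nat -> R -> R) (z : R) : R :=
  pieces x p q (xget 0%N [set k | z < x k]) z.

Definition matching {R : realType} (x : nat -> R) (p : R -> R)
    (q : nat -> R -> R) : Prop :=
  p (x 0%N) = q 0%N (x 0%N) /\ forall k, q k (x k.+1) = q k.+1 (x k.+1).

Section glued_pieces.
Context {R : realType} (x : nat -> R) (x_incr : forall k, x k < x k.+1).
Implicit Types (p : R -> R) (q : nat -> R -> R).

Lemma nodes_le : {homo x : i j / (i <= j)%N >-> i <= j}.
Proof. by apply: homo_leq => [//|??? /le_trans|k]; [apply|exact: ltW]. Qed.

Lemma pieces_stable p q z N M :
  z <= x N -> (N <= M)%N -> pieces x p q M z = pieces x p q N z.
Proof.
move=> zN; elim: M => [|M IH]; first by rewrite leqn0 => /eqP ->.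
rewrite leq_eqVlt => /predU1P[->//|NM] /=.
by rewrite ifT ?IH// (le_trans zN)// nodes_le.
Qed.

Lemma gluedE p q z k : z < x k -> glued x p q z = pieces x p q k z.
Proof.
move=> zk; rewrite /glued; case: xgetP => [m _ /= zm|/(_ k)//].
case: (leqP k m) => [|/ltnW] km; first exact: pieces_stable (ltW zk) km.
by apply/esym; exact: pieces_stable (ltW zm) km.
Qed.

Lemma pieces_node p q N : matching x p q -> pieces x p q N (x N) = q N (x N).
Proof.
by move=> [m0 mS]; case: N => [//|N] /=; rewrite leNgt x_incr mS.
Qed.

Lemma glued_left p q z : z <= x 0%N -> glued x p q z = p z.
Proof.
move=> z0; rewrite (@gluedE _ _ _ 1%N) ?(le_lt_trans z0)//.
by rewrite (@pieces_stable _ _ _ 0%N).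
Qed.

Lemma glued_mid p q z k : matching x p q -> x k <= z <= x k.+1 ->
  glued x p q z = q k z.
Proof.
move=> pq /andP[kz zk].
rewrite (@gluedE _ _ _ k.+2) ?(le_lt_trans zk)//.
rewrite (@pieces_stable _ _ _ k.+1)//=; case: ifPn => // zk'.
have -> : z = x k by apply/eqP; rewrite eq_le zk' kz.
exact: pieces_node.
Qed.

Lemma pieces_is_derive p q p1 q1 N (z : R) : matching x p q -> matching x p1 q1 ->
  (forall z : R, is_derive z 1 p (p1 z)) ->
  (forall k (z : R), is_derive z 1 (q k) (q1 k z)) ->
  is_derive z 1 (pieces x p q N) (pieces x p1 q1 N z).
Proof.
move=> pq pq1 dp dq; elim: N z => [//|N IH] z /=.
by apply: glue_is_derive => //; rewrite pieces_node.
Qed.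

Lemma pieces_continuous p q N : matching x p q -> continuous p ->
  (forall k, continuous (q k)) -> continuous (pieces x p q N).
Proof.
move=> pq cp cq; elim: N => [//|N IH] z /=.
apply: glue_continuous; first exact: pieces_node.
  by move=> _; exact: IH.
by move=> _; exact: cq.
Qed.

(** Makes the regularity of the infinite gluing a matter of finitely many joints. *)
Lemma near_gluedE p q z k : z < x k ->
  \forall y \near z, pieces x p q k y = glued x p q y.
Proof.
move=> zk; near=> y; rewrite (@gluedE _ _ _ k)//.
by near: y; exact: lt_nbhsl.
Unshelve. all: by end_near. Qed.

Lemma glued_is_derive p q p1 q1 k (z : R) :
  matching x p q -> matching x p1 q1 ->
  (forall z : R, is_derive z 1 p (p1 z)) ->
  (forall k (z : R), is_derive z 1 (q k) (q1 k z)) ->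
  z < x k -> is_derive z 1 (glued x p q) (glued x p1 q1 z).
Proof.
move=> pq pq1 dp dq zk; rewrite (gluedE _ _ _ _ zk).
apply: near_eq_is_derive (near_gluedE _ _ _ _ zk) _.
exact: pieces_is_derive.
Qed.

Lemma glued_continuous p q k (z : R) : matching x p q -> continuous p ->
  (forall k, continuous (q k)) -> z < x k -> {for z, continuous (glued x p q)}.
Proof.
move=> pq cp cq zk; rewrite /prop_for /continuous_at (gluedE _ _ _ _ zk).
apply: cvg_trans (pieces_continuous _ _ _ pq cp cq z).
by apply: near_eq_cvg; exact: near_gluedE zk.
Qed.

Lemma nodes_locate z N : x 0%N <= z -> z < x N ->
  exists k, x k <= z <= x k.+1.
Proof.
move=> z0; elim: N => [|N IH]; first by rewrite ltNge z0.
by case: (ltP z (x N)) => [/IH//|Nz zN]; exists N; rewrite Nz ltW.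
Qed.

End glued_pieces.

(** * Reparametrizing along a sequence of nodes *)

Lemma is_derive_affine {R : realType} (a b z : R) :
  is_derive z 1 (fun y => a + b * y) b.
Proof.
have -> : (fun y : R => a + b * y) = horner (a%:P + b *: 'X).
  by apply/funext => w; rewrite !hornerE.
apply: is_derive_eq.
by rewrite !(derivD, derivZ, derivX, derivC) !hornerE.
Qed.

Lemma is_derive_continuous {R : realType} (f : R -> R) (x df : R) :
  is_derive x 1 f df -> {for x, continuous f}.
Proof. by move=> [fx _]; exact/differentiable_continuous/derivable1_diffP. Qed.

Lemma MVT_closed {R : realType} (f df : R -> R) (a b : R) : a <= b ->
  (forall z : R, a <= z <= b -> is_derive z 1 f (df z)) ->
  exists2 c, a <= c <= b & f b - f a = df c * (b - a).
Proof.
move=> ab fdf; have [||c cab ->] := @MVT_segment _ f df _ _ ab.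
- by move=> z; rewrite in_itv/= => /andP[az zb]; apply: fdf; rewrite !ltW.
- apply: continuous_in_subspaceT => z; rewrite inE/= in_itv/= => /fdf.
  exact: is_derive_continuous.
- by exists c.
Qed.

(** Node [s k] is reached at time [x k], the sum of the [t j] with [j < k]; [B] makes the total time
    [X] finite. On piece [k] the speed is at most [3 t k], so its square times [K] is at most
    [9 (s k.+1 - s k) K <= 9 D]. The affine continuation to [z <= 0] with prescribed slope [e0] is
    what the other half is attached to. *)
Lemma half_reparametrization {R : realType} (K : R -> R) (c l D B e0 : R)
    (s : nat -> R) :
  (forall y, 0 <= K y) -> s 0%N = c -> (forall k, s k < s k.+1) ->
  (forall k, s k < l) -> (forall y, y < l -> exists k, y < s k) ->
  (forall k y, s k <= y <= s k.+1 -> (s k.+1 - s k) * K y <= D) ->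
  (forall N, \sum_(k < N) Num.sqrt (s k.+1 - s k) <= B) ->
  0 < e0 <= Num.sqrt (s 1%N - s 0%N) ->
  exists (X : R) (h h1 h2 : R -> R) (C : R),
  [/\ 0 < X,
      forall z : R, z < X -> [/\ is_derive z 1 h (h1 z),
        is_derive z 1 h1 (h2 z) & {for z, continuous h2}],
      forall z, z <= 0 -> [/\ h z = c + e0 * z, h1 z = e0 & h2 z = 0],
      forall z, 0 <= z < X -> [/\ 0 < h1 z, `|h2 z| <= C,
        h1 z ^+ 2 * K (h z) <= C & h z < l] &
      forall y, y < l -> exists2 z, 0 <= z < X & y < h z].
Proof.
move=> K0 s0 sS sl scof sK sumB /andP[e0_gt0 e0t].
pose t k := Num.sqrt (s k.+1 - s k).
have t0 k : 0 < t k by rewrite sqrtr_gt0 subr_gt0.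
have tE k : t k ^+ 2 = s k.+1 - s k by rewrite sqr_sqrtr// subr_ge0 ltW.
pose x N := \sum_(k < N) t k.
have xS k : x k < x k.+1 by rewrite /x big_ord_recr/= ltrDl.
have xSE k : x k.+1 - x k = t k by rewrite /x big_ord_recr/= [X in X - _]addrC addrK.
have x0 : x 0%N = 0 by rewrite /x big_ord0.
(* Speed at a node: the smaller of the average speeds of the two adjacent pieces, so that
   [transition_piece] applies on both sides. *)
pose e k := if k is j.+1 then Num.min (t j) (t j.+1) else e0.
have ek k : 0 < e k <= t k.
  case: k => [|k]; first by rewrite e0_gt0.
  by rewrite /= lt_min !t0/= ge_min lexx orbT.
have eS k : 0 < e k.+1 <= t k by rewrite /= lt_min !t0/= ge_min lexx.
have [Q Qp] := choice (fun k => transition_piece _ _ _ (t0 k) (ek k) (eS k)).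
have Q1 k : forall v : R, is_derive v 1 (Q k).1.1 ((Q k).1.2 v).
  by case: (Qp k).
have Q2 k : forall v : R, is_derive v 1 (Q k).1.2 ((Q k).2 v).
  by case: (Qp k).
have Q3 k : continuous (Q k).2 by case: (Qp k).
have shiftD (f df : R -> R) (a z : R) :
    (forall v : R, is_derive v 1 f (df v)) ->
    is_derive z 1 (fun y => f (y - a)) (df (z - a)).
  move=> fdf; have := @is_derive1_comp _ f (shift (- a)) z _ _ (fdf _)
    (is_derive_shift z 1 (- a)).
  by rewrite mulr1.
pose q0 k z := s k + (Q k).1.1 (z - x k).
pose q1 k z := (Q k).1.2 (z - x k).
pose q2 k z := (Q k).2 (z - x k).
pose p0 z := c + e0 * z.
pose p1 := fun _ : R => e0.
pose p2 := fun _ : R => 0 : R.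
have M0 : matching x p0 q0.
  split.
    by rewrite /p0 /q0 x0 mulr0 subrr s0; case: (Qp 0%N) => _ _ _ [-> _ _].
  move=> k; rewrite /q0 xSE subrr.
  case: (Qp k) => _ _ _ _ [[-> _ _] _]; case: (Qp k.+1) => _ _ _ [-> _ _] _.
  by rewrite tE addr0 addrC subrK.
have M1 : matching x p1 q1.
  split; first by rewrite /p1 /q1 x0 subrr; case: (Qp 0%N) => _ _ _ [_ -> _].
  move=> k; rewrite /q1 xSE subrr.
  by case: (Qp k) => _ _ _ _ [[_ -> _] _]; case: (Qp k.+1) => _ _ _ [_ -> _].
have M2 : matching x p2 q2.
  split; first by rewrite /p2 /q2 x0 subrr; case: (Qp 0%N) => _ _ _ [_ _ ->].
  move=> k; rewrite /q2 xSE subrr.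
  by case: (Qp k) => _ _ _ _ [[_ _ ->] _]; case: (Qp k.+1) => _ _ _ [_ _ ->].
have Dp0 (z : R) : is_derive z 1 p0 (p1 z).
  exact: is_derive_affine.
have Dp1 (z : R) : is_derive z 1 p1 (p2 z) by exact: is_derive_cst.
have Dq0 k (z : R) : is_derive z 1 (q0 k) (q1 k z).
  have D1 := shiftD _ _ (x k) z (Q1 k).
  have := is_deriveD (is_derive_cst (s k) z 1) D1.
  by rewrite add0r.
have Dq1 k (z : R) : is_derive z 1 (q1 k) (q2 k z) by exact: shiftD (Q2 k).
have cq2 k : continuous (q2 k).
  move=> z; apply: (@continuous_comp _ _ _ (shift (- x k)) (Q k).2).
    by apply: cvgD; [exact: cvg_id|exact: cvg_cst].
  exact: Q3.
pose X := sup (range x).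
have xB k : x k <= B by exact: sumB.
have hsX : has_sup (range x).
  by split; [exists (x 0%N); exists 0%N|exists B => _ [k _ <-]].
have xX k : x k < X.
  apply: (lt_le_trans (xS k)); apply: (sup_upper_bound hsX).
  by exists k.+1.
have Xx z : z < X -> exists k, z < x k.
  move=> zX; have [|_ [k _ <-] zk] := @sup_adherent _ (range x) (X - z) _ hsX.
    by rewrite subr_gt0.
  by exists k; move: zk; rewrite -/X subKr.
have loc z : 0 <= z < X -> exists k, x k <= z <= x k.+1.
  move=> /andP[z0 /Xx[k zk]]; apply: (nodes_locate _ _ k) => //.
  by rewrite x0.
(* A piece moves monotonically from [0] to [t k ^+ 2], so [q0 k] stays between [s k] and [s k.+1],
   where [sK] bounds [K]. *)
have ran k v : 0 <= v <= t k -> (Q k).1.1 v <= t k ^+ 2 /\ 0 <= (Q k).1.1 v.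
  move=> /andP[v0 vt].
  case: (Qp k) => _ _ _ [Z0 _ _] [[Zt _ _] bd].
  split.
    have [w /andP[vw wt] E] := MVT_closed _ _ _ _ vt (fun z _ => Q1 k z).
    rewrite -Zt -subr_ge0 E mulr_ge0 ?subr_ge0//.
    have [|/andP[/ltW + _] _] := bd w; last by [].
    by rewrite (le_trans v0 vw).
  have [w /andP[vw wt] E] := MVT_closed _ _ _ _ v0 (fun z _ => Q1 k z).
  rewrite -[leRHS]subr0 -[X in _ - X]Z0 E mulr_ge0 ?subr_ge0//.
  have [|/andP[/ltW + _] _] := bd w; last by [].
  by rewrite vw (le_trans wt vt).
exists X, (glued x p0 q0), (glued x p1 q1), (glued x p2 q2),
  (Num.max 66 (9 * D)).
split.
- by rewrite -x0.
- move=> z /Xx[k zk]; split.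
  + exact: (glued_is_derive _ xS _ _ _ _ k).
  + exact: (glued_is_derive _ xS _ _ _ _ k).
  + by apply: (glued_continuous _ xS _ _ k) => //; exact: cst_continuous.
- by move=> z z0; rewrite !(glued_left _ xS) ?x0.
- move=> z /loc[k zk]; rewrite !(glued_mid _ xS _ _ _ k)//.
  have vt : 0 <= z - x k <= t k.
    by move: zk; rewrite -(xSE k) subr_ge0 lerD2r.
  case: (Qp k) => _ _ _ _ [_ /(_ _ vt)[/andP[q1_gt0 q1_le] q2_le]].
  have [r1 r2] := ran _ _ vt.
  split => //.
  + by rewrite /q2 le_max q2_le.
  + rewrite le_max; apply/orP; right.
    apply: (@le_trans _ _ ((3 * t k) ^+ 2 * K (q0 k z))).
      rewrite ler_wpM2r// ler_pXn2r// ?nnegrE; first exact: ltW.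
      by rewrite mulr_ge0// ltW.
    rewrite exprMn tE (_ : 3 ^+ 2 = 9) -?natrX// -mulrA ler_wpM2l//.
    apply: sK; rewrite /q0 lerDl r2/=.
    by rewrite -lerBrDl -tE.
  + apply: le_lt_trans (sl k.+1); rewrite /q0 -lerBrDl -tE.
    exact: r1.
- move=> y /scof[k yk]; exists (x k).
    by rewrite xX andbT -x0 nodes_le.
  rewrite (glued_mid _ xS _ _ _ k)// ?lexx ?ltW// /q0 subrr.
  by case: (Qp k) => _ _ _ [-> _ _] _; rewrite addr0.
Qed.

(** [K] stands for the curvature or its reflection under [y -> l - y], so that one notion serves
    both ends. Up to a factor, [D] will bound [h'^2 K]; [B] bounds the time needed to approach
    [l]. *)
Definition node_system {R : realType} (K : R -> R) (c l : R) : Prop :=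
  exists (D B : R) (s : nat -> R),
  [/\ s 0%N = c, forall k, s k < s k.+1,
      (forall k, s k < l) /\ (forall y, y < l -> exists k, y < s k),
      forall k y, s k <= y <= s k.+1 -> (s k.+1 - s k) * K y <= D &
      forall N, \sum_(k < N) Num.sqrt (s k.+1 - s k) <= B].

Lemma le_derive_ge0 {R : realType} (f df : R -> R) (a b : R) : a <= b ->
  (forall z : R, a <= z <= b -> is_derive z 1 f (df z)) ->
  (forall z, a <= z <= b -> 0 <= df z) -> f a <= f b.
Proof.
move=> ab fdf df0; have [w wab E] := MVT_closed _ _ _ _ ab fdf.
by rewrite -subr_ge0 E mulr_ge0 ?subr_ge0// df0.
Qed.

Lemma lt_derive_gt0 {R : realType} (f df : R -> R) (a b : R) : a < b ->
  (forall z : R, a <= z <= b -> is_derive z 1 f (df z)) ->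
  (forall z, a <= z <= b -> 0 < df z) -> f a < f b.
Proof.
move=> ab fdf df0; have [w wab E] := MVT_closed _ _ _ _ (ltW ab) fdf.
by rewrite -subr_gt0 E mulr_gt0 ?subr_gt0// df0.
Qed.

Lemma is_derive_comp_affine {R : realType} (f df : R -> R) (a b z : R) :
  is_derive (a + b * z) 1 f (df (a + b * z)) ->
  is_derive z 1 (fun y => f (a + b * y)) (b * df (a + b * z)).
Proof.
move=> D; rewrite mulrC.
exact: (@is_derive1_comp _ f (fun y => a + b * y) z _ _ D (is_derive_affine a b z)).
Qed.

Lemma continuous_comp_affine {R : realType} (f : R -> R) (a b z : R) :
  {for a + b * z, continuous f} -> {for z, continuous (fun y => f (a + b * y))}.
Proof.
move=> cf; apply: (@continuous_comp _ _ _ (fun y => a + b * y) f) => //.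
by apply: is_derive_continuous; exact: is_derive_affine.
Qed.

Lemma reparametrization_of_nodes {R : realType} (K : R -> R) (c l : R) :
  (forall y, 0 <= K y) -> 0 < c < l ->
  node_system K c l -> node_system (fun y => K (l - y)) (l - c) l ->
  exists (H H1 H2 : R -> R) (C : R),
  [/\ forall z : R, 0 < z < 1 -> [/\ is_derive z 1 H (H1 z),
        is_derive z 1 H1 (H2 z) & {for z, continuous H2}],
      forall z, 0 < z < 1 -> [/\ 0 < H1 z, `|H2 z| <= C,
        H1 z ^+ 2 * K (H z) <= C & 0 < H z < l] &
      forall y, 0 < y < l -> exists z z', [/\ 0 < z < 1, 0 < z' < 1 &
        H z < y < H z']].
Proof.
move=> K0 /andP[c0 cl] [DR [BR [sR [R0 RS [Rl Rc] RK RB]]]]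
  [DL [BL [sL [L0 LS [Ll Lc] LK LB]]]].
pose e0 := Num.min (Num.sqrt (sR 1%N - sR 0%N)) (Num.sqrt (sL 1%N - sL 0%N)).
have e0R : 0 < e0 <= Num.sqrt (sR 1%N - sR 0%N).
  by rewrite lt_min !sqrtr_gt0 !subr_gt0 RS LS/= ge_min lexx.
have e0L : 0 < e0 <= Num.sqrt (sL 1%N - sL 0%N).
  by rewrite lt_min !sqrtr_gt0 !subr_gt0 RS LS/= ge_min lexx orbT.
have [X [r [r1 [r2 [CR [X0 rD rneg rpos rcof]]]]]] :=
  half_reparametrization _ _ _ _ _ _ _ K0 R0 RS Rl Rc RK RB e0R.
have K0' y : 0 <= K (l - y) by [].
have [Y [q [q1 [q2 [CL [Y0 qD qneg qpos qcof]]]]]] :=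
  half_reparametrization _ _ _ _ _ _ _ K0' L0 LS Ll Lc LK LB e0L.
(* Each half is affine with slope [e0] on the side of the other one, so subtracting the common germ
   [c + e0 z] from the sum glues them without a case distinction. The form [0 + (- 1) * z] of [- z]
   fits [is_derive_comp_affine]. *)
pose h z := (r z + (l - q (0 + (- 1) * z))) - (c + e0 * z).
pose h1 z := (r1 z + q1 (0 + (- 1) * z)) - e0.
pose h2 z := r2 z - q2 (0 + (- 1) * z).
have N z : 0 + (-1) * z = - z by rewrite add0r mulN1r.
have hr z : 0 <= z -> [/\ h z = r z, h1 z = r1 z & h2 z = r2 z].
  move=> z0; have [|E0 E1 E2] := qneg (- z); first by rewrite oppr_le0.
  by rewrite /h /h1 /h2 N E0 E1 E2; split; ring.
have hq z : z <= 0 -> [/\ h z = l - q (- z), h1 z = q1 (- z) & h2 z = - q2 (- z)].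
  move=> z0; have [//|E0 E1 E2] := rneg z.
  by rewrite /h /h1 /h2 N E0 E1 E2; split; ring.
have hD (z : R) : - Y < z < X -> [/\ is_derive z 1 h (h1 z),
    is_derive z 1 h1 (h2 z) & {for z, continuous h2}].
  move=> /andP[Yz zX]; have [a1 a2 a3] := rD _ zX.
  have Yz' : 0 + (-1) * z < Y by rewrite N ltrNl.
  have [b1 b2 b3] := qD _ Yz'.
  split.
  - have d1 := is_derive_comp_affine _ _ _ _ _ b1.
    have d2 := is_deriveB (is_deriveD a1 (is_deriveB (is_derive_cst l z 1) d1))
       (is_derive_affine c e0 z).
    by apply: (is_derive_eq d2); rewrite /h1; ring.
  - have d1 := is_derive_comp_affine _ _ _ _ _ b2.
    have d2 := is_deriveB (is_deriveD a2 d1) (is_derive_cst e0 z 1).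
    by apply: (is_derive_eq d2); rewrite /h2; ring.
  - by apply: cvgB => //; exact: (continuous_comp_affine q2).
have hP z : - Y < z < X -> [/\ 0 < h1 z, `|h2 z| <= Num.max CR CL &
    h1 z ^+ 2 * K (h z) <= Num.max CR CL].
  move=> /andP[Yz zX]; case: (leP 0 z) => z0.
    have [-> -> ->] := hr _ z0.
    have [|p1 p2 p3 _] := rpos z; first by rewrite z0.
    by rewrite !le_max p2 p3.
  have [-> -> ->] := hq _ (ltW z0).
  have [|p1 p2 p3 _] := qpos (- z); first by rewrite oppr_ge0 ltW//= ltrNl.
  by rewrite !le_max normrN p2 p3 !orbT.
have h0 : h 0 = c by have [-> _ _] := hr 0 (lexx 0); have [//|-> _ _] := rneg 0;
  rewrite ?mulr0 ?addr0.
have hl z : - Y < z < X -> 0 < h z < l.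
  move=> /andP[Yz zX]; case: (leP 0 z) => z0.
    have hc : h 0 <= h z.
      apply: (le_derive_ge0 _ h1) => // w /andP[w0 wz].
        have [|//] := hD w.
        by rewrite (lt_le_trans _ w0) ?oppr_lt0// (le_lt_trans wz).
      have [|/ltW//] := hP w.
      by rewrite (lt_le_trans _ w0) ?oppr_lt0// (le_lt_trans wz).
    rewrite (lt_le_trans c0) -?h0//=.
    have [-> _ _] := hr _ z0.
    by have [|_ _ _ ->] := rpos z; rewrite ?z0.
  have hc : h z <= h 0.
    apply: (le_derive_ge0 _ h1) => [|w /andP[zw w0]|w /andP[zw w0]].
    - exact: ltW.
    - have [|//] := hD w.
      by rewrite (lt_le_trans Yz zw) (le_lt_trans w0).
    - have [|/ltW//] := hP w.
      by rewrite (lt_le_trans Yz zw) (le_lt_trans w0).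
  rewrite (le_lt_trans hc) ?h0// andbT.
  have [-> _ _] := hq _ (ltW z0).
  rewrite subr_gt0.
  by have [|_ _ _ ->//] := qpos (- z); rewrite oppr_ge0 ltW//= ltrNl.
(* Rescaling []- Y, X[] to []0, 1[] multiplies the speed by [a], and both bounded quantities by
   [a ^+ 2]. *)
pose a := Y + X.
have a0 : 0 < a by rewrite addr_gt0.
have sc z : 0 < z < 1 -> - Y < - Y + a * z < X.
  move=> /andP[z0 z1]; rewrite ltrDl mulr_gt0//= addrC ltrBlDr addrC.
  by rewrite gtr_pMr.
pose C := Num.max CR CL.
have C0 : 0 <= C by have [|_ /(le_trans (normr_ge0 _)) + _] := hP 0;
  rewrite ?oppr_lt0 ?Y0.
exists (fun z => h (- Y + a * z)), (fun z => a * h1 (- Y + a * z)),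
  (fun z => a * (a * h2 (- Y + a * z))), (a ^+ 2 * C).
split.
- move=> z /sc/hD[d1 d2 d3]; split.
  + exact: is_derive_comp_affine.
  + have d := is_derive_comp_affine _ _ _ _ _ d2.
    exact: (is_deriveZ a d).
  + do 2 apply: cvgMr => //.
    exact: continuous_comp_affine.
- move=> z /sc zz; have [p1 p2 p3] := hP _ zz; split.
  + by rewrite mulr_gt0.
  + by rewrite mulrA -expr2 normrM ger0_norm ?sqr_ge0// ler_wpM2l// sqr_ge0.
  + by rewrite exprMn -mulrA ler_wpM2l// sqr_ge0.
  + exact: hl.
- move=> y /andP[y0 yl].
  have inv w : - Y < w < X -> exists2 z, 0 < z < 1 & - Y + a * z = w.
    move=> /andP[Yw wX]; exists ((w + Y) / a); last first.
      by field; rewrite gt_eqF.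
    rewrite divr_gt0//= ?ltr_pdivrMr// ?mul1r; last by rewrite -ltrBlDr sub0r.
    by rewrite /a addrC ltrD2l.
  have [w' /andP[w'0 w'X] yw'] := rcof y yl.
  have [|z' z'01 z'E] := inv w'.
    by rewrite w'X (lt_le_trans _ w'0)// oppr_lt0.
  have [|w /andP[w0 wY] yw] := qcof (l - y); first by rewrite gtrBl.
  have [|z z01 zE] := inv (- w).
    by rewrite ltrN2 wY (le_lt_trans _ X0)// oppr_le0.
  exists z, z'; split => //; rewrite zE z'E.
  have [-> _ _] := hr _ w'0.
  have [|-> _ _] := hq (- w); first by rewrite oppr_le0.
  by rewrite opprK yw' andbT ltrBlDr -ltrBlDl.
Qed.

(** * Greedy subdivision *)

Lemma segment_max {R : realType} (K : R -> R) (a b : R) : a <= b ->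
  (forall y, a <= y <= b -> {for y, continuous K}) ->
  exists2 m, a <= m <= b & forall y, a <= y <= b -> K y <= K m.
Proof.
move=> ab cK; have cW : {within `[a, b], continuous K}.
  by apply: continuous_in_subspaceT => z; rewrite inE/= in_itv/=; exact: cK.
by have [m + Km] := EVT_max ab cW; rewrite in_itv/= => mab; exists m.
Qed.

(* [b] is the largest point up to the midpoint with [(b - a) max K <= delta]. *)
Lemma greedy_step {R : realType} (K : R -> R) (a l delta : R) :
  a < l -> 0 < delta -> (forall y, 0 <= K y) ->
  (forall y, a <= y < l -> {for y, continuous K}) ->
  exists b, [/\ a < b <= (a + l) / 2,
    forall y, a <= y <= b -> (b - a) * K y <= delta &
    b = (a + l) / 2 \/ exists2 y, a <= y <= b & (b - a) * K y = delta].
Proof.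
move=> al d0 K0 cK; set m := (a + l) / 2.
have am : a < m by rewrite /m; lra.
have ml : m < l by rewrite /m; lra.
pose E := [set b | a <= b <= m /\
  forall y, a <= y <= b -> (b - a) * K y <= delta].
have Ea : E a.
  by split; [rewrite lexx ltW|move=> y _; rewrite subrr mul0r ltW].
have hsE : has_sup E by split; [exists a|exists m => b [/andP[]]].
pose b := sup E.
have bm : b <= m by apply: ge_sup => [|c [/andP[]]]; first by exists a.
have Eb c : E c -> c <= b by move=> Ec; apply: sup_upper_bound.
have [M Mam KM] : exists2 M, a <= M <= m & forall y, a <= y <= m -> K y <= K M.
  apply: segment_max => [|y /andP[ay ym]]; first exact: ltW.
  by apply: cK; rewrite ay (le_lt_trans ym).
(* Up to the midpoint [K <= K M], so a step of length at most [delta / (K M + 1)] is admissible; the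
   [+ 1] covers [K M = 0]. *)
have ab : a < b.
  pose c := Num.min m (a + delta / (K M + 1)).
  have KM1 : 0 < K M + 1 by rewrite ltr_wpDl.
  have ac : a < c by rewrite lt_min am ltrDl divr_gt0.
  apply: (lt_le_trans ac); apply: Eb; split.
    by rewrite ltW//= ge_min lexx.
  move=> y /andP[ay yc].
  have ym : y <= m by rewrite (le_trans yc)// ge_min lexx.
  apply: (@le_trans _ _ (delta / (K M + 1) * (K M + 1))).
    rewrite ler_pM// ?subr_ge0 ?(ltW ac)//.
      by rewrite lerBlDl ge_min lexx orbT.
    by rewrite (le_trans (KM y _)) ?ay ?ym// lerDl.
  by rewrite divfK// gt_eqF.
have Kb y : a <= y < b -> (b - a) * K y <= delta.
  move=> /andP[ay yb]; rewrite leNgt; apply/negP => bad.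
  have Ky : 0 < K y.
    rewrite lt_neqAle K0 andbT; apply/eqP => Ky.
    by move: bad; rewrite -Ky mulr0 ltNge ltW.
  (* A point [c] of [E] with [c > b - e] lies beyond [y] and still satisfies [(c - a) K y > delta],
     contradicting [c] in [E]. *)
  pose e := Num.min (b - y) (b - (a + delta / K y)).
  have e0 : 0 < e.
    rewrite lt_min subr_gt0 yb/= subr_gt0 -ltrBrDl ltr_pdivrMr//.
  have [c [/andP[ac cm] Ec] ec] := sup_adherent e0 hsE.
  have yc : y <= c.
    apply: ltW; apply: le_lt_trans ec; rewrite -/b lerBrDl -lerBrDr.
    by rewrite ge_min lexx.
  have := Ec y; rewrite ay yc => /(_ isT); rewrite leNgt => /negP; apply.
  rewrite -ltr_pdivrMr// ltrBrDl.
  apply: le_lt_trans ec; rewrite -/b lerBrDl -lerBrDr.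
  by rewrite ge_min lexx orbT.
have bl : b < l by exact: le_lt_trans bm ml.
have cb : {for b, continuous K} by apply: cK; rewrite ltW.
(* By continuity, a violation at [b] would persist at points slightly to its left, where [Kb]
   excludes it. *)
have Kbb : (b - a) * K b <= delta.
  rewrite leNgt; apply/negP => bad.
  have ba : 0 < b - a by rewrite subr_gt0.
  have : \forall y \near b, delta / (b - a) < K y.
    by apply: (cvgr_gt _ cb); rewrite ltr_pdivrMr// mulrC.
  move=> nb.
  have : \forall y \near b, a < y by exact: lt_nbhsr.
  move=> na; have [e /= e0 be] := filterI nb na.
  have [|Ky ay] := be (b - e / 2).
    rewrite /ball_/= opprB addrC subrK ger0_norm; last by rewrite divr_ge0// ltW.
    by rewrite ltr_pdivrMr// ltr_pMr// ltr1n.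
  have := Kb (b - e / 2); rewrite (ltW ay) gtrBl divr_gt0// => /(_ isT).
  by rewrite mulrC leNgt -ltr_pdivrMr// Ky.
have Kcb y : a <= y <= b -> (b - a) * K y <= delta.
  by move=> /andP[ay]; rewrite le_eqVlt => /predU1P[->//|yb]; apply: Kb; rewrite ay.
exists b; split=> //; first by rewrite ab.
have [->|bm'] := eqVneq b m; first by left.
right; apply: contrapT => nex.
have Klt y : a <= y <= b -> (b - a) * K y < delta.
  move=> yab; rewrite lt_neqAle Kcb// andbT; apply/eqP => Ky.
  by apply: nex; exists y.
have {bm'} bm' : b < m by rewrite lt_neqAle bm'.
have [M1 M1ab KM1] : exists2 M, a <= M <= b & forall y, a <= y <= b -> K y <= K M.
  apply: segment_max => [|y /andP[ay yb]]; first exact: ltW.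
  by apply: cK; rewrite ay (le_lt_trans yb).
have ba : 0 < b - a by rewrite subr_gt0.
(* A level strictly between the maximum of [K] on [[a, b]] and [delta / (b - a)]. As [K] stays below
   it slightly beyond [b], the set [E] would contain points beyond its supremum. *)
pose mu := (K M1 + delta / (b - a)) / 2.
have Kmu : K M1 < delta / (b - a) by rewrite ltr_pdivlMr// mulrC Klt.
have mu1 : K M1 < mu by rewrite /mu; lra.
have mu2 : mu < delta / (b - a) by rewrite /mu; lra.
have mu0 : 0 < mu by apply: le_lt_trans mu1.
have nb : \forall y \near b, K y < mu.
  by apply: (cvgr_lt _ cb); rewrite (le_lt_trans _ mu1)// KM1// lexx ltW.
have nm : \forall y \near b, y < m by exact: lt_nbhsl.
have nd : \forall y \near b, y < a + delta / mu.
  by apply: lt_nbhsl; rewrite -ltrBlDl ltr_pdivlMr// mulrC -ltr_pdivlMr.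
have [e /= e0 be] := filterI nb (filterI nm nd).
have near_b y : b <= y <= b + e / 2 -> [/\ K y < mu, y < m & y < a + delta / mu].
  move=> /andP[by_ ye]; have [|? []//] := be y.
  rewrite /ball_/= distrC ger0_norm ?subr_ge0// ltrBlDl (le_lt_trans ye)//.
  by rewrite ltrD2l ltr_pdivrMr// ltr_pMr// ltr1n.
have e20 : 0 < e / 2 by rewrite divr_gt0.
have := Eb (b + e / 2); rewrite leNgt ltrDl e20 => h; apply: (elimF idP _ (h _)) => //.
have [|_ c1 c2] := near_b (b + e / 2); first by rewrite lexx lerDl ltW.
split; first by rewrite (ltW c1) (le_trans (ltW ab))// lerDl ltW.
move=> y /andP[ay yc].
have Ky : K y <= mu.
  case: (leP y b) => yb; first by rewrite (le_trans (KM1 _ _)) ?ay ?yb// ltW.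
  by have [|/ltW//] := near_b y; rewrite (ltW yb).
apply: (@le_trans _ _ (delta / mu * mu)); last by rewrite divfK// gt_eqF.
rewrite ler_pM//; last by rewrite lerBlDl ltW.
by rewrite subr_ge0 (le_trans (ltW ab))// lerDl ltW.
Qed.

Definition greedy {R : realType} (K : R -> R) (l delta : R) (s : nat -> R) :=
  forall k, [/\ s k < s k.+1 <= (s k + l) / 2,
    forall y, s k <= y <= s k.+1 -> (s k.+1 - s k) * K y <= delta &
    s k.+1 = (s k + l) / 2 \/
    exists2 y, s k <= y <= s k.+1 & (s k.+1 - s k) * K y = delta].

Lemma greedy_lt {R : realType} (K : R -> R) (l delta : R) (s : nat -> R) :
  s 0%N < l -> greedy K l delta s -> forall k, s k < l.
Proof.
move=> s0 gs; elim=> [//|k IH]; case: (gs k) => /andP[_ h] _ _.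
by rewrite (le_lt_trans h)//; lra.
Qed.

Lemma greedy_mono {R : realType} (K : R -> R) (l delta : R) (s : nat -> R) :
  greedy K l delta s -> {homo s : i j / (i <= j)%N >-> i <= j}.
Proof. by move=> gs; apply: nodes_le => k; case: (gs k) => /andP[]. Qed.

Lemma greedy_exists {R : realType} (K : R -> R) (c l delta : R) :
  c < l -> 0 < delta -> (forall y, 0 <= K y) ->
  (forall y, c <= y < l -> {for y, continuous K}) ->
  exists2 s : nat -> R, s 0%N = c & greedy K l delta s.
Proof.
move=> cl d0 K0 cK.
have /choice[g gP] a : exists b, c <= a < l -> [/\ a < b <= (a + l) / 2,
    forall y, a <= y <= b -> (b - a) * K y <= delta &
    b = (a + l) / 2 \/ exists2 y, a <= y <= b & (b - a) * K y = delta].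
  have [/andP[ca al]|nca] := boolP (c <= a < l); last by exists a.
  have [//|//|//||b bP] := greedy_step K a l delta; last by exists b.
  by move=> y /andP[ay yl]; apply: cK; rewrite yl (le_trans ca).
exists (fun k => iter k g c) => //.
suff H k : c <= iter k g c < l by move=> k; exact: gP (H k).
elim: k => [|k /[dup] /andP[ck kl] /gP[/andP[k1 k2] _ _]] /=.
  by rewrite lexx.
by rewrite (le_trans ck (ltW k1)) (le_lt_trans k2)//; lra.
Qed.

(** If all nodes stayed at or below some [y < l], then [K <= K M] along the walk and each step,
    midpoint or saturated, would be at least [eta] long, against the Archimedean property. *)
Lemma greedy_cofinal {R : realType} (K : R -> R) (l delta : R) (s : nat -> R) :
  s 0%N < l -> 0 < delta -> (forall y, 0 <= K y) ->
  (forall y, s 0%N <= y < l -> {for y, continuous K}) ->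
  greedy K l delta s -> forall y, y < l -> exists k, y < s k.
Proof.
move=> s0l d0 K0 cK gs y yl; apply: contrapT => nex.
have sy k : s k <= y by rewrite leNgt; apply/negP => h; apply: nex; exists k.
have smon := greedy_mono _ _ _ _ gs.
have [M _ KM] : exists2 M, s 0%N <= M <= y &
    forall z, s 0%N <= z <= y -> K z <= K M.
  apply: segment_max => // z /andP[sz zy].
  by apply: cK; rewrite sz (le_lt_trans zy).
have KM1 : 0 < K M + 1 by rewrite ltr_wpDl.
pose eta := Num.min ((l - y) / 2) (delta / (K M + 1)).
have eta0 : 0 < eta by rewrite lt_min !divr_gt0// subr_gt0.
have sk k : s 0%N + eta *+ k <= s k.
  elim: k => [|k IH]; first by rewrite mulr0n addr0.
  rewrite mulrSr addrA (le_trans (lerD IH (lexx eta)))//.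
  rewrite -lerBrDl; case: (gs k) => /andP[s1 s2] _ [->|[z /andP[kz zk] zE]].
    rewrite ge_min; apply/orP; left; have := sy k; lra.
  rewrite ge_min; apply/orP; right.
  rewrite ler_pdivrMr// -zE ler_pM2l ?subr_gt0//.
  rewrite (le_trans (KM z _)) ?lerDl// (le_trans _ kz) ?smon//=.
  by rewrite (le_trans zk).
have /archi_boundP : 0 <= (y - s 0%N) / eta.
  by rewrite divr_ge0 ?(ltW eta0)// subr_ge0.
set N := Num.Def.archi_bound _; rewrite ltr_pdivrMr// mulr_natl => yk.
by have := le_trans (sk N) (sy N); rewrite -lerBrDl leNgt yk.
Qed.

(* A midpoint step halves [l - s k], so the square roots of the lengths of
   such steps telescope. *)
Lemma greedy_sum {R : realType} (K : R -> R) (l delta : R) (s : nat -> R) N :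
  s 0%N < l -> greedy K l delta s ->
  \sum_(k < N) Num.sqrt (s k.+1 - s k) <=
    3 * Num.sqrt (l - s 0%N) +
    \sum_(k < N | s k.+1 != (s k + l) / 2) Num.sqrt (s k.+1 - s k).
Proof.
move=> s0l gs; have sl := greedy_lt _ _ _ _ s0l gs.
(* The induction needs the telescoped term [sqrt (l - s N)], which is dropped only at the end. *)
suff : \sum_(k < N) Num.sqrt (s k.+1 - s k) <=
    3 * (Num.sqrt (l - s 0%N) - Num.sqrt (l - s N)) +
    \sum_(k < N | s k.+1 != (s k + l) / 2) Num.sqrt (s k.+1 - s k).
  move=> /le_trans; apply; rewrite lerD2r ler_pM2l// gerBl.
  exact: sqrtr_ge0.
elim: N => [|N IH]; first by rewrite !big_ord0 subrr mulr0 addr0.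
rewrite [leLHS]big_ord_recr/= [X in _ <= _ + X]big_mkcond big_ord_recr/=.
rewrite -big_mkcond/= addrA.
set A := \sum_(_ < _) _ in IH *; set B := \sum_(_ < _ | _) _ in IH *.
case: (gs N) => /andP[s1 s2] _ _.
have [sE|_] /= := eqVneq (s N.+1) ((s N + l) / 2); last first.
  rewrite lerD2r (le_trans IH)// lerD2r ler_pM2l// lerD2l lerN2.
  by rewrite ler_wsqrtr// lerD2l lerN2 ltW.
have e1 : l - s N.+1 = s N.+1 - s N by rewrite sE; lra.
have e2 : l - s N = 2 * (s N.+1 - s N) by rewrite sE; lra.
move: IH; rewrite e1 e2 addr0; set t := s N.+1 - s N.
have t0 : 0 <= t by rewrite subr_ge0 ltW.
(* At a midpoint step [l - s N.+1 = t] and [l - s N = 2 t]. As [(4 / 3)^2 <= 2], the difference of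
   the square roots is at least a third of [sqrt t], whence the factor [3]. *)
have h : 4 / 3 * Num.sqrt t <= Num.sqrt (2 * t).
  rewrite -[4 / 3]ger0_norm ?divr_ge0// -sqrtr_sqr -sqrtrM ?sqr_ge0// ler_wsqrtr//.
  by rewrite ler_wpM2r//; lra.
set d0 := Num.sqrt (l - _); lra.
Qed.

(** Condition (ii) for a bare function [K], so that it can be reflected. The predicate [P] picks the
    saturated steps out of a greedy sequence without renumbering them. *)
Definition separated_sum_bound {R : realType} (K : R -> R) (l delta V : R) :=
  forall N (a b : 'I_N -> R) (P : pred 'I_N),
    (forall k, 0 < a k /\ a k < b k < l) ->
    (forall i j : 'I_N, i != j -> b i <= a j \/ b j <= a i) ->
    (forall k, P k -> exists y, [/\ a k <= y <= b k,
      forall z, a k <= z <= b k -> K z <= K y & delta <= (b k - a k) * K y]) ->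
    \sum_(k < N | P k) Num.sqrt (b k - a k) <= V.

(* [F] plays the role of a primitive of [sqrt K]. *)
Definition sqrt_integral_bound {R : realType} (K : R -> R) (l : R) :=
  exists (F : R -> R) (J : R), (forall y : R, 0 < y < l -> 0 <= F y <= J) /\
    forall a b m : R, 0 < a -> a < b -> b < l -> 0 <= m ->
      (forall y : R, a <= y <= b -> m ^+ 2 <= K y) -> m * (b - a) <= F b - F a.

Lemma separated_sum_bound_reflect {R : realType} (K : R -> R) (l delta V : R) :
  separated_sum_bound K l delta V ->
  separated_sum_bound (fun y => K (l - y)) l delta V.
Proof.
move=> KV N a b P ab sep Pmax.
have := KV N (fun k => l - b k) (fun k => l - a k) P.
have E k : l - a k - (l - b k) = b k - a k by ring.
under eq_bigr do rewrite E.
apply.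
- by move=> k; have [a0 /andP[akb bl]] := ab k; split; lra.
- by move=> i j ij; have [h|h] := sep _ _ ij; [right|left]; lra.
- move=> k /Pmax[y [/andP[ay yb] ymax dy]]; exists (l - y); split.
  + by apply/andP; split; lra.
  + by move=> z /andP[bz za]; rewrite -[z](subKr l); apply: ymax;
      apply/andP; split; lra.
  + by rewrite E.
Qed.

Lemma sqrt_integral_bound_reflect {R : realType} (K : R -> R) (l : R) :
  sqrt_integral_bound K l -> sqrt_integral_bound (fun y => K (l - y)) l.
Proof.
(* The reflected primitive, shifted by [J] to stay in [[0, J]]. *)
move=> [F [J [FJ FK]]]; exists (fun y => J - F (l - y)), J; split.
  move=> y /andP[y0 yl]; have /andP[] : 0 <= F (l - y) <= J by apply: FJ; lra.
  by move=> *; apply/andP; split; lra.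
move=> a b m a0 ab bl m0 mK.
have := FK (l - b) (l - a) m; rewrite (_ : l - a - (l - b) = b - a); last by ring.
rewrite (_ : J - _ - _ = F (l - a) - F (l - b)); last by ring.
apply; [lra|lra|lra|by []|].
by move=> y /andP[y1 y2]; rewrite -[y](subKr l); apply: mK; apply/andP; split; lra.
Qed.

(** The greedy walk is run with this very [delta]. On a step that is not a midpoint step, [delta] is
    attained at some [y], and the upper bound on the step makes [y] a maximum point of [K]; hence
    these steps satisfy the requirements of [separated_sum_bound]. *)
Lemma node_system_of_sum_bound {R : realType} (K : R -> R) (c l delta V : R) :
  0 < c < l -> 0 < delta -> (forall y, 0 <= K y) ->
  (forall y, 0 < y < l -> {for y, continuous K}) ->
  separated_sum_bound K l delta V -> node_system K c l.
Proof.
move=> /andP[c0 cl] d0 K0 cK KV.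
have cK' y : c <= y < l -> {for y, continuous K}.
  by move=> /andP[cy yl]; apply: cK; rewrite yl (lt_le_trans c0).
have [s s0 gs] := greedy_exists K c l delta cl d0 K0 cK'.
have s0l : s 0%N < l by rewrite s0.
have sS k : s k < s k.+1 by case: (gs k) => /andP[].
have smon := greedy_mono _ _ _ _ gs.
have sl := greedy_lt _ _ _ _ s0l gs.
exists delta, (3 * Num.sqrt (l - s 0%N) + V), s; split => //.
- split => //; apply: (greedy_cofinal K l delta) => //.
  by rewrite s0.
- by move=> k; case: (gs k).
move=> N; rewrite (le_trans (greedy_sum _ _ _ _ N s0l gs))// lerD2l.
apply: (KV N (fun k : 'I_N => s k) (fun k : 'I_N => s k.+1)
  (fun k : 'I_N => s k.+1 != (s k + l) / 2)).
- move=> k; rewrite sS sl; split=> //.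
  by rewrite (lt_le_trans c0)// -s0 smon.
- move=> i j; case: (ltngtP i j) => [ij _|ji _|/val_inj ->].
  + by left; exact: smon.
  + by right; exact: smon.
  + by rewrite eqxx.
- move=> k kE; case: (gs k) => _ Kk [|[y yk yE]]; first by move/eqP : kE.
  exists y; split => //; last by rewrite yE.
  move=> z zk; have sk : 0 < s k.+1 - s k by rewrite subr_gt0.
  by rewrite -(ler_pM2l sk) yE Kk.
Qed.

(** One more step, from [c] to [c'], is put in front; [K] is bounded on this compact interval. This
    allows a walk to start inside the region of monotonicity. *)
Lemma node_system_extend {R : realType} (K : R -> R) (c c' l : R) :
  c <= c' < l -> (forall y, 0 <= K y) ->
  (forall y, c <= y < l -> {for y, continuous K}) ->
  node_system K c' l -> node_system K c l.
Proof.
move=> /andP[]; rewrite le_eqVlt => /predU1P[-> //|cc'] cl K0 cK.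
move=> [D [B [s [s0 sS [sl sc] sK sB]]]].
have [M _ KM] : exists2 M, c <= M <= c' & forall y, c <= y <= c' -> K y <= K M.
  apply: segment_max => [|y /andP[cy yc]]; first exact: ltW.
  by apply: cK; rewrite cy (le_lt_trans yc).
exists (Num.max D ((c' - c) * K M)), (Num.sqrt (c' - c) + B),
  (fun k => if k is j.+1 then s j else c); split => //.
- by case=> [|k] //; rewrite s0.
- split; first by case=> [|k] //; rewrite (lt_trans cc').
  by move=> y /sc[k yk]; exists k.+1.
- case=> [|k] y; last by move=> /sK; rewrite le_max => ->.
  rewrite s0 => /KM yM; rewrite le_max; apply/orP; right.
  by rewrite ler_wpM2l// subr_ge0 ltW.
- case=> [|N].
    rewrite big_ord0 addr_ge0 ?sqrtr_ge0//.
    by have := sB 0%N; rewrite big_ord0.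
  by rewrite big_ord_recl/= s0 lerD2l; exact: sB.
Qed.

(** If [K] decreases towards [l], it is at most [K c'] along the walk, so a saturated step of length
    [L] has [sqrt L <= sqrt (K c') L], and these bounds telescope. If [K] increases, a saturated
    step makes [sqrt K >= 1 / t k] on the next one, and the integral bound yields a contracting
    recurrence for the [t k]. *)
Lemma node_system_of_monotone {R : realType} (K : R -> R) (c e l : R) :
  0 < c < l -> e < l -> (forall y, 0 <= K y) ->
  (forall y, 0 < y < l -> {for y, continuous K}) ->
  sqrt_integral_bound K l -> monotone_on `]e, l[ K -> node_system K c l.
Proof.
move=> /andP[c0 cl] el K0 cK [F [J [FJ FK]]] Kmon.
pose c' := Num.max c ((e + l) / 2).
have cc' : c <= c' by rewrite le_max lexx.
have c'l : c' < l by rewrite gt_max cl/=; lra.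
have ec' : e < c' by rewrite lt_max; apply/orP; right; lra.
have cK1 y : c <= y < l -> {for y, continuous K}.
  by move=> /andP[cy yl]; apply: cK; rewrite yl (lt_le_trans c0).
apply: (node_system_extend K c c') => //; first by rewrite cc'.
have cK' y : c' <= y < l -> {for y, continuous K}.
  by move=> /andP[cy yl]; apply: cK1; rewrite yl (le_trans cc').
have [s s0 gs] := greedy_exists K c' l 1 c'l ltr01 K0 cK'.
have s0l : s 0%N < l by rewrite s0.
have sS k : s k < s k.+1 by case: (gs k) => /andP[].
have smon := greedy_mono _ _ _ _ gs.
have sl := greedy_lt _ _ _ _ s0l gs.
have c's k : c' <= s k by rewrite -s0 smon.
have s_gt0 k : 0 < s k by rewrite (lt_le_trans c0)// (le_trans cc').
have Kin y k : s k <= y -> y < l -> y \in `]e, l[.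
  move=> ky yl; rewrite inE/= in_itv/= yl andbT.
  by rewrite (lt_le_trans ec')// (le_trans (c's k)).
suff [B HB] : exists B, forall N, \sum_(k < N) Num.sqrt (s k.+1 - s k) <= B.
  exists 1, B, s; split => //.
  - split => //; apply: (greedy_cofinal K l 1) => //.
    by rewrite s0.
  - by move=> k; case: (gs k).
case: Kmon => Kmon; last first.
  exists (3 * Num.sqrt (l - s 0%N) + Num.sqrt (K c') * (l - c')) => N.
  rewrite (le_trans (greedy_sum _ _ _ _ N s0l gs))// lerD2l.
  have eqk k : s k.+1 != (s k + l) / 2 ->
      Num.sqrt (s k.+1 - s k) <= Num.sqrt (K c') * (s k.+1 - s k).
    move=> kE; case: (gs k) => _ _ [|[y /andP[ky yk] yE]]; first by move/eqP : kE.
    have d0 : 0 <= s k.+1 - s k by rewrite subr_ge0 ltW.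
    rewrite -{2}(sqr_sqrtr d0) expr2 mulrA -[leLHS]mul1r ler_wpM2r ?sqrtr_ge0//.
    rewrite -sqrtrM// -[leLHS]sqrtr1 ler_wsqrtr// -yE mulrC ler_wpM2r//.
    have yl : y < l by rewrite (le_lt_trans yk).
    apply: Kmon; [|exact: (Kin y k)|exact: le_trans ky].
    by apply: (Kin _ 0%N) => //; rewrite s0.
  apply: (@le_trans _ _ (\sum_(k < N) Num.sqrt (K c') * (s k.+1 - s k))).
    rewrite big_mkcond/= ler_sum// => k _; case: ifPn => [/eqk//|_].
    by rewrite mulr_ge0 ?sqrtr_ge0// subr_ge0 ltW.
  rewrite -mulr_sumr ler_wpM2l ?sqrtr_ge0//.
  rewrite -(big_mkord xpredT (fun k => s k.+1 - s k)) telescope_sumr// s0.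
  by rewrite lerD2r ltW.
pose t k : R := Num.sqrt (s k.+1 - s k).
have tE k : t k ^+ 2 = s k.+1 - s k by rewrite sqr_sqrtr// subr_ge0 ltW.
have t0 k : 0 < t k by rewrite sqrtr_gt0 subr_gt0.
have F0 k : 0 <= F (s k.+1) - F (s k).
  rewrite -(mul0r (s k.+1 - s k)); apply: FK => // y _.
  by rewrite expr0n.
(* After a midpoint step the next step is at most half as long, and [1 / sqrt 2 <= 3 / 4]. After a
   saturated step [t k.+1 ^+ 2 / t k <= d] for the increment [d] of [F], hence
   [t k.+1 <= (t k + d) / 2] by AM-GM. *)
have rec k : t k.+1 <= 3 / 4 * t k + (F (s k.+2) - F (s k.+1)).
  case: (gs k) => _ Kk [kE|[y /andP[ky yk] yE]].
    have : t k.+1 ^+ 2 <= t k ^+ 2 / 2.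
      by rewrite !tE; case: (gs k.+1) => /andP[_ +] _ _; rewrite kE; lra.
    move=> h; rewrite -[leLHS]addr0 lerD// -(@ler_pXn2r _ 2) ?nnegrE//.
    - by rewrite exprMn; have := sqr_ge0 (t k); lra.
    - exact: ltW.
    - by rewrite mulr_ge0// ltW.
  (* Saturation somewhere on the step forces saturation at its right end, where the nondecreasing
     [K] is largest. *)
  have Kk1 : K (s k.+1) = (t k)^-1 ^+ 2.
    apply/eqP; rewrite exprVn -[_^-1]mul1r eq_sym; apply/eqP.
    apply: (canLR (mulfK _)); first by rewrite sqrf_eq0 gt_eqF.
    apply/eqP; rewrite tE mulrC eq_le Kk ?lexx ?andbT; last exact: ltW.
    rewrite -{1}yE ler_wpM2l//; first by rewrite subr_ge0 ltW.
    have yl : y < l by rewrite (le_lt_trans yk).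
    by apply: Kmon => //; [exact: (Kin y k)|exact: (Kin _ k.+1)].
  have : (t k)^-1 * (s k.+2 - s k.+1) <= F (s k.+2) - F (s k.+1).
    apply: FK => //; first by rewrite invr_ge0 ltW.
    move=> z /andP[z1 z2]; rewrite -Kk1; apply: Kmon => //.
    - exact: (Kin _ k.+1).
    - by apply: (Kin _ k.+1); rewrite // (le_lt_trans z2).
  rewrite -tE mulrC ler_pdivrMr//; move: (F0 k.+1).
  move: (F (s k.+2) - F (s k.+1)) => d d0 h.
  have h2 : t k.+1 <= (t k + d) / 2.
    rewrite -(@ler_pXn2r _ 2) ?nnegrE ?divr_ge0 ?addr_ge0// ?(ltW (t0 _))//.
    rewrite (le_trans h)// -subr_ge0.
    have -> : ((t k + d) / 2) ^+ 2 - d * t k = ((t k - d) / 2) ^+ 2 by field.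
    exact: sqr_ge0.
  by have := t0 k; lra.
have FsJ k : 0 <= F (s k) <= J by apply: FJ; rewrite s_gt0 sl.
exists (4 * t 0%N + 4 * J) => N.
(* The term [3 * t M] is a potential: the induction step is four times [rec],
   [4 t M.+1 <= 3 t M + 4 d]. *)
have claim M : \sum_(k < M.+1) t k + 3 * t M <=
    4 * t 0%N + 4 * (F (s M.+1) - F (s 1%N)).
  elim: M => [|M IH]; first by rewrite big_ord1; lra.
  by rewrite big_ord_recr/=; have := rec M; lra.
apply: (@le_trans _ _ (\sum_(k < N.+1) t k)).
  by rewrite big_ord_recr/= lerDl ltW.
have := claim N; have := t0 N; have := FsJ N.+1; have := FsJ 1%N.
by move=> /andP[? ?] /andP[? ?]; lra.
Qed.

(** * Integrals and measures *)

Lemma leb_length_itv {R : realType} (a b : R) : a <= b ->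
  leb_length `[a, b] = b - a.
Proof.
rewrite /leb_length lebesgue_measure_itv/= lte_fin le_eqVlt.
by case/predU1P => [->|->]; rewrite ?ltxx ?subrr//= -EFinB.
Qed.

Lemma Vdelta_sum_bound {R : realType} (n : nat) (l : R) (f : R -> 'rV[R]_n)
    (delta : R) : (Vdelta l f delta < +oo)%E ->
  exists V, separated_sum_bound (curvature1 f) l delta V.
Proof.
move=> Vfin; exists (fine (Vdelta l f delta)) => N a b P ab sep Pmax.
have adm (m : nat) (a' b' : 'I_m -> R) : admissible_system l f delta a' b' ->
    ((\sum_(k < m) Num.sqrt (leb_length `[a' k, b' k]))%:E <= Vdelta l f delta)%E.
  by move=> ad; apply: ereal_sup_ubound; exists m, a', b'.
(* Witnessed by the empty system; together with [Vfin] it makes [Vdelta] a finite number. *)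
have V0 : (0 <= Vdelta l f delta)%E.
  have := adm 0%N (fun=> 0) (fun=> 0); rewrite big_ord0; apply.
  by split; [case|move=> [] //|case].
have Vnum : Vdelta l f delta \is a fin_num by rewrite ge0_fin_numE.
rewrite -lee_fin fineK// (eq_bigl (fun k => k \in [pred k | P k]))// big_enum_val/=.
have := adm #|[pred k | P k]| (a \o enum_val) (b \o enum_val).
have -> : \sum_(k < #|[pred k | P k]|)
    Num.sqrt (leb_length `[(a \o enum_val) k, (b \o enum_val) k]) =
    \sum_(i < #|[pred k | P k]|) Num.sqrt (b (enum_val i) - a (enum_val i)).
  apply: eq_bigr => i _ /=; rewrite leb_length_itv// ltW//.
  by have [_ /andP[]] := ab (enum_val i).
apply; split => /=.
- move=> k; have [a0 /andP[akb bl]] := ab (enum_val k); split => //.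
  move=> z /=; rewrite !in_itv/= => /andP[az zb].
  by rewrite (lt_le_trans a0 az) (le_lt_trans zb bl).
- apply/trivIsetP => i j _ _ ij; rewrite !interior_itv -subset0 => z/= [].
  rewrite !in_itv/= => /andP[a1 b1] /andP[a2 b2].
  have [|h|h] := sep (enum_val i) (enum_val j).
  + by apply: contra ij => /eqP/enum_val_inj ->.
  + by move: (lt_trans a2 b1); rewrite ltNge h.
  + by move: (lt_trans a1 b2); rewrite ltNge h.
- move=> k; have [|y [yk ymax dy]] := Pmax (enum_val k).
    by have := enum_valP k.
  exists (curvature1 f y).
    split; first by exists y => //=; rewrite in_itv.
    by move=> _ [z /= + <-]; rewrite in_itv/=; exact: ymax.
  rewrite leb_length_itv// ltW//.
  by have [_ /andP[]] := ab (enum_val k).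
Qed.

Lemma measurable_sqrt_comp {R : realType} (K : R -> R) (l : R) :
  (forall y, 0 < y < l -> {for y, continuous K}) ->
  measurable_fun `]0, l[ (fun y => (Num.sqrt (K y))%:E).
Proof.
move=> cK; apply/measurable_EFinP; apply: open_continuous_measurable_fun.
  exact: itv_open.
move=> y; rewrite inE/= in_itv/= => yl.
apply: continuous_comp; first exact: cK.
exact: sqrt_continuous.
Qed.

(** [F y] is the integral of [sqrt K] over []0, y]] and [J] the full integral; comparison with the
    constant [m] on []a, b]] gives the lower bound. *)
Lemma integrable_sqrt_integral_bound {R : realType} (K : R -> R) (l : R) :
  (forall y, 0 < y < l -> {for y, continuous K}) ->
  (\int[lebesgue_measure]_(s in `]0%R, l[) (Num.sqrt (K s))%:E < +oo)%E ->
  sqrt_integral_bound K l.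
Proof.
move=> cK fin.
have mK := measurable_sqrt_comp _ _ cK.
pose g y := (Num.sqrt (K y))%:E.
have g0 y : (0 <= g y)%E by rewrite lee_fin sqrtr_ge0.
pose G y := (\int[lebesgue_measure]_(s in `]0%R, y]) g s)%E.
have sub y : y < l -> `]0, y] `<=` `]0, l[.
  by move=> yl z /=; rewrite !in_itv/= => /andP[-> zy]; exact: le_lt_trans yl.
have mS (i : interval R) : [set` i] `<=` `]0, l[ -> measurable_fun [set` i] g.
  by move=> il; exact: measurable_funS mK.
have Gle y : y < l -> (G y <= \int[lebesgue_measure]_(s in `]0%R, l[) g s)%E.
  by move=> yl; apply: ge0_subset_integral => //; exact: sub.
have G0 y : (0 <= G y)%E by exact: integral_ge0.
have Gfin y : y < l -> G y \is a fin_num.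
  by move=> yl; rewrite ge0_fin_numE// (le_lt_trans (Gle y yl)).
exists (fine \o G), (fine (\int[lebesgue_measure]_(s in `]0%R, l[) g s)%E).
split.
  move=> y /andP[y0 yl] /=; rewrite fine_ge0 ?G0//=.
  apply: fine_le; [exact: Gfin| |exact: Gle].
  by rewrite ge0_fin_numE//; exact: integral_ge0.
move=> a b m a0 ab bl m0 mK' /=.
have al : a < l by exact: lt_trans bl.
rewrite -lee_fin EFinB !fineK ?Gfin//.
have subab : `]a, b] `<=` `]0, l[.
  move=> z /=; rewrite !in_itv/= => /andP[az zb].
  by rewrite (lt_trans a0 az) (le_lt_trans zb).
have -> : G b = (G a + \int[lebesgue_measure]_(s in `]a, b]) g s)%E.
  have E : `]0, b] = `]0, a] `|` `]a, b].
    by apply: itv_bndbnd_setU; rewrite bnd_simp// ltW.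
  rewrite /G E ge0_integral_setU//.
  - by rewrite -E; exact: (mS _ (sub _ bl)).
  - apply/disj_setPS => z [/=]; rewrite !in_itv/= => /andP[_ za] /andP[az _].
    by move: (lt_le_trans az za); rewrite ltxx.
rewrite addeAC subee ?Gfin// add0e.
apply: (@le_trans _ _ (\int[lebesgue_measure]_(s in `]a, b]) (cst m%:E) s)%E).
  by rewrite integral_cst//= lebesgue_measure_itv/= lte_fin ab EFinM EFinB.
apply: ge0_le_integral => //=.
- by apply: mS.
- move=> z; rewrite in_itv/= => /andP[az zb]; rewrite lee_fin.
  rewrite -(ger0_norm m0) -sqrtr_sqr ler_wsqrtr// mK'// zb ltW//.
Qed.

(** Monotone convergence along compact intervals exhausting []0, l[]; the divisor [i.+3] makes each
    of them nondegenerate. *)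
Lemma integral_itvoo_lty {R : realType} (g : R -> R) (l C : R) : 0 < l ->
  measurable_fun `]0, l[ (EFin \o g) -> (forall y, 0 <= g y) ->
  (forall u v : R, 0 < u -> u < v -> v < l ->
    (\int[lebesgue_measure]_(s in `[u, v]) (g s)%:E <= C%:E)%E) ->
  (\int[lebesgue_measure]_(s in `]0%R, l[) (g s)%:E < +oo)%E.
Proof.
move=> l0 mg g0 gC.
pose F i : set R := `[l / i.+3%:R, l - l / i.+3%:R].
have i3 i : 0 < l / i.+3%:R by rewrite divr_gt0.
have sub i : F i `<=` `]0, l[.
  rewrite /F => z /=; rewrite !in_itv/= => /andP[az zb].
  by rewrite (lt_le_trans _ az)//= (le_lt_trans zb)// gtrBl.
have FU : \bigcup_i F i = `]0, l[.
  rewrite eqEsubset; split; first by move=> z [i _ /sub].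
  move=> z /=; rewrite in_itv/= => /andP[z0 zl].
  pose e := Num.min z (l - z).
  have e0 : 0 < e by rewrite lt_min z0 subr_gt0.
  have /archi_boundP : 0 <= l / e by rewrite divr_ge0// ltW.
  set N := Num.Def.archi_bound _ => lN.
  have Ne : l / N.+3%:R <= e.
    rewrite ler_pdivrMr// mulrC -ler_pdivrMr// (le_trans (ltW lN))// ler_nat.
    by rewrite -addn3 leq_addr.
  exists N => //; rewrite /F/= in_itv/= (le_trans Ne) ?ge_min ?lexx//=.
  by rewrite lerBrDl -lerBrDr (le_trans Ne)// ge_min lexx orbT.
have cv := @ge0_nondecreasing_set_cvg_integral _ (measurableTypeR R) R F (EFin \o g)
  lebesgue_measure.
rewrite -FU; apply: (@le_lt_trans _ _ C%:E); last exact: ltry.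
have {}cv : (\int[lebesgue_measure]_(x in F i) (EFin \o g) x)%E @[i --> \oo] -->
    (\int[lebesgue_measure]_(x in \bigcup_i F i) (EFin \o g) x)%E.
  apply: cv.
  - apply/nondecreasing_seqP => i; rewrite subsetEset /F => z /=.
    rewrite !in_itv/= => /andP[az zb].
    have h : l / i.+4%:R <= l / i.+3%:R.
      by rewrite ler_wpM2l ?(ltW l0)// lef_pV2 ?posrE// ler_nat.
    by rewrite (le_trans h az)/= (le_trans zb)// lerD2l lerN2.
  - by move=> i; exact: measurable_itv.
  - by move=> i; apply: measurable_funS mg => //; exact: sub.
  - by move=> i x _; rewrite lee_fin.
apply: (cvge_to_le cv); apply: nearW => i.
apply: gC => //.
- rewrite ltrBrDl -mulrDl ltr_pdivrMr//.
  by rewrite -[X in X + _]mulr1 -[X in _ + X]mulr1 -mulrDr ltr_pM2l// (ltr_nat _ 2).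
- by rewrite gtrBl.
Qed.

(** * Curves in Euclidean space *)

Definition dot {R : realType} {n : nat} (x y : 'rV[R]_n) : R :=
  \sum_(i < n) x 0 i * y 0 i.

Section euclidean_norm.
Context {R : realType} {n : nat}.
Implicit Types x y z : 'rV[R]_n.

Lemma enorm_ge0 x : 0 <= enorm x. Proof. exact: sqrtr_ge0. Qed.

Lemma sqr_enorm x : enorm x ^+ 2 = dot x x.
Proof. by rewrite sqr_sqrtr ?sumr_ge0// => i _; exact: sqr_ge0. Qed.

Lemma dotZr a x y : dot x (a *: y) = a * dot x y.
Proof. by rewrite mulr_sumr; apply: eq_bigr => i _; rewrite mxE; ring. Qed.

Lemma dotBr x y z : dot x (y - z) = dot x y - dot x z.
Proof. by rewrite -sumrB; apply: eq_bigr => i _; rewrite !mxE mulrBr. Qed.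

Lemma dotDr x y z : dot x (y + z) = dot x y + dot x z.
Proof. by rewrite -big_split; apply: eq_bigr => i _; rewrite !mxE mulrDr. Qed.

Lemma dotC x y : dot x y = dot y x.
Proof. by apply: eq_bigr => i _; rewrite mulrC. Qed.

Lemma enorm0_eq0 x : enorm x = 0 -> x = 0.
Proof.
move=> x0; have : dot x x = 0 by rewrite -sqr_enorm x0 expr0n.
move=> /eqP; rewrite psumr_eq0; last by move=> i _; exact: sqr_ge0.
move=> /allP h; apply/rowP => i; rewrite mxE.
by have := h i (mem_index_enum i); rewrite /= mulf_eq0 orbb => /eqP.
Qed.

Lemma enorm_gt0 x : x != 0 -> 0 < enorm x.
Proof.
move=> x0; rewrite lt_neqAle enorm_ge0 andbT eq_sym.
by apply: contra x0 => /eqP/enorm0_eq0 ->.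
Qed.

Lemma enormZ a x : enorm (a *: x) = `|a| * enorm x.
Proof.
rewrite /enorm -sqrtr_sqr -sqrtrM ?sqr_ge0//; congr Num.sqrt.
by rewrite mulr_sumr; apply: eq_bigr => i _; rewrite mxE exprMn.
Qed.

Lemma enormN x : enorm (- x) = enorm x.
Proof. by rewrite -scaleN1r enormZ normrN1 mul1r. Qed.

Lemma ler_dot x y : dot x y <= enorm x * enorm y.
Proof.
have [/enorm0_eq0 ->|y0] := eqVneq (enorm y) 0.
  rewrite /dot big1 ?mulr_ge0 ?enorm_ge0// => i _.
  by rewrite mxE mulr0.
have yy : 0 < dot y y by rewrite -sqr_enorm exprn_gt0// lt_neqAle eq_sym y0 enorm_ge0.
apply: (@le_trans _ _ `|dot x y|); first exact: ler_norm.
rewrite -(@ler_pXn2r _ 2) ?nnegrE ?mulr_ge0 ?enorm_ge0// exprMn !sqr_enorm.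
rewrite real_normK ?num_real// -(ler_pM2l yy) -subr_ge0.
(* Cauchy-Schwarz from [0 <= |z|^2 = (y.y) ((x.x) (y.y) - (x.y)^2)], an identity without
   divisions. *)
pose z := dot y y *: x - dot x y *: y.
have := sqr_ge0 (enorm z); rewrite sqr_enorm {2}/z dotBr !dotZr.
rewrite ![dot z _]dotC /z !dotBr !dotZr [dot y x]dotC => h.
by apply: le_trans h _; rewrite le_eqVlt; apply/orP; left; apply/eqP; ring.
Qed.

Lemma ler_norm_dot x y : `|dot x y| <= enorm x * enorm y.
Proof.
rewrite ler_norml ler_dot andbT lerNl -mulN1r -dotZr.
by rewrite (le_trans (ler_dot _ _))// enormZ normrN1 mul1r.
Qed.

Lemma ler_enormD x y : enorm (x + y) <= enorm x + enorm y.
Proof.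
rewrite -(@ler_pXn2r _ 2) ?nnegrE ?addr_ge0 ?enorm_ge0// sqr_enorm.
rewrite dotDr dotC dotDr [dot (x + y) y]dotC dotDr sqrrD !sqr_enorm.
by rewrite [dot y x]dotC; have := ler_dot x y; lra.
Qed.

Lemma enorm_continuous : continuous (@enorm R n).
Proof.
have c : continuous (fun x : 'rV[R]_n => \sum_(i < n) x 0 i ^+ 2).
  apply: continuous_big => [|i _ x]; first exact: add_continuous.
  have := @continuous_comp _ _ _ (fun x : 'rV[R]_n => x 0 i)
    (fun z : R => z ^+ 2) x; apply.
    exact: coord_continuous.
  exact: exprn_continuous.
move=> x; apply: (@continuous_comp _ _ _ _ Num.sqrt); first exact: c.
exact: sqrt_continuous.
Qed.

Lemma is_derive_rowP (f : R -> 'rV[R]_n) (t : R) (df : 'rV[R]_n) :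
  is_derive t 1 f df <-> forall i, is_derive t 1 (fun u => f u 0 i) (df 0 i).
Proof.
split=> [[fd <-] i|fi].
  have fdi := (derivable_mxP f t 1).1 fd.
  by rewrite derive_mx// mxE; apply: derivableP.
have fd : derivable f t 1.
  by apply/derivable_mxP => i j; rewrite (ord1 i); case: (fi j).
split => //; rewrite derive_mx//; apply/rowP => i; rewrite mxE.
by case: (fi i).
Qed.

Lemma is_derive_dotr w (f : R -> 'rV[R]_n) (t : R) (df : 'rV[R]_n) :
  is_derive t 1 f df -> is_derive t 1 (fun u => dot w (f u)) (dot w df).
Proof.
move=> /is_derive_rowP fi.
have -> : (fun u => dot w (f u)) = \sum_(i < n) (w 0 i \*: (fun u => f u 0 i)).
  by apply/funext => u; rewrite fct_sumE.
by apply: is_derive_sum => i; exact: is_deriveZ.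
Qed.

Lemma is_derive_dot (f g : R -> 'rV[R]_n) (t : R) (df dg : 'rV[R]_n) :
  is_derive t 1 f df -> is_derive t 1 g dg ->
  is_derive t 1 (fun u => dot (f u) (g u)) (dot (f t) dg + dot df (g t)).
Proof.
move=> /is_derive_rowP fi /is_derive_rowP gi.
have -> : (fun u => dot (f u) (g u)) =
    \sum_(i < n) ((fun u => f u 0 i) * (fun u => g u 0 i)).
  by apply/funext => u; rewrite fct_sumE.
have -> : dot (f t) dg + dot df (g t) =
    \sum_(i < n) (f t 0 i *: dg 0 i + g t 0 i *: df 0 i).
  by rewrite -big_split; apply: eq_bigr => i _ /=; rewrite [_ * g t 0 i]mulrC.
by apply: is_derive_sum => i; exact: is_deriveM.
Qed.

Lemma is_derive_row_continuous (f : R -> 'rV[R]_n) (t : R) (df : 'rV[R]_n) :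
  is_derive t 1 f df -> {for t, continuous f}.
Proof. by move=> [fx _]; exact/differentiable_continuous/derivable1_diffP. Qed.

Lemma is_derive_row_comp (f : R -> 'rV[R]_n) (h : R -> R) (t dh : R)
    (df : 'rV[R]_n) :
  is_derive (h t) 1 f df -> is_derive t 1 h dh ->
  is_derive t 1 (f \o h) (dh *: df).
Proof.
move=> /is_derive_rowP fi hd; apply/is_derive_rowP => i; rewrite mxE mulrC.
exact: (@is_derive1_comp _ (fun u => f u 0 i) h).
Qed.

Lemma is_derive_row_scale (k : R -> R) (f : R -> 'rV[R]_n) (t dk : R)
    (df : 'rV[R]_n) :
  is_derive t 1 k dk -> is_derive t 1 f df ->
  is_derive t 1 (fun u => k u *: f u) (dk *: f t + k t *: df).
Proof.
move=> kd /is_derive_rowP fi; apply/is_derive_rowP => i.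
have -> : (fun u => (k u *: f u) 0 i) = k * (fun u => f u 0 i).
  by apply/funext => u; rewrite mxE.
have := is_deriveM kd (fi i); rewrite !mxE addrC.
by rewrite [_ *: dk]mulrC.
Qed.

Lemma is_derive_enorm (f : R -> 'rV[R]_n) (t : R) (df : 'rV[R]_n) :
  f t != 0 -> is_derive t 1 f df ->
  is_derive t 1 (fun u => enorm (f u)) (dot (f t) df / enorm (f t)).
Proof.
move=> ft0 fd.
have d := is_derive_dot _ _ _ _ _ fd fd.
have p : 0 < dot (f t) (f t) by rewrite -sqr_enorm exprn_gt0// enorm_gt0.
have := @is_derive1_comp _ Num.sqrt (fun u => dot (f u) (f u)) _ _ _
  (is_derive1_sqrt p) d.
rewrite [dot df _]dotC => h; apply: (is_derive_eq h).
rewrite -sqr_enorm sqrtr_sqr ger0_norm ?enorm_ge0//.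
have : enorm (f t) != 0 by rewrite gt_eqF// enorm_gt0.
by move=> ?; field.
Qed.

End euclidean_norm.

(** * Derivatives of curves and unit speed *)

Section C2_curves.
Context {R : realType} {n : nat}.
Implicit Types f g : R -> 'rV[R]_n.

Lemma near_itvoo (a b x : R) : a < x < b -> \forall y \near x, a < y < b.
Proof.
move=> xab; have := @near_in_itvoo R a b x; rewrite in_itv/= => /(_ xab).
by apply: filterS => y; rewrite in_itv.
Qed.

Lemma C2_on_is_derive a b f : C2_on a b f -> forall x : R, a < x < b ->
  [/\ is_derive x 1 f (f^`()%classic x),
      is_derive x 1 f^`()%classic (f^`(2)%classic x) &
      {for x, continuous f^`(2)%classic}].
Proof.
move=> fC2 x xab; have [|d1 d2 c] := fC2 x; first by rewrite in_itv.
split; last exact: c.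
- by have := derivableP d1; rewrite -derive1E; exact.
- by have := derivableP d2; rewrite -derive1E; exact.
Qed.

Lemma C2_on_of_is_derive (a b : R) g (g1 g2 : R -> 'rV[R]_n) :
  (forall x : R, a < x < b -> [/\ is_derive x 1 g (g1 x),
    is_derive x 1 g1 (g2 x) & {for x, continuous g2}]) ->
  [/\ C2_on a b g, forall x, a < x < b -> g^`()%classic x = g1 x &
    forall x, a < x < b -> g^`(2)%classic x = g2 x].
Proof.
move=> gP.
have E1 x : a < x < b -> g^`()%classic x = g1 x.
  by move=> /gP[[_ <-] _ _]; rewrite -derive1E.
have D2 x : a < x < b -> is_derive x 1 g^`()%classic (g2 x).
  move=> xab; have [_ d _] := gP _ xab.
  apply: near_eq_is_derive d; near=> y; rewrite E1//.
  by near: y; exact: near_itvoo.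
have E2 x : a < x < b -> g^`(2)%classic x = g2 x.
  by move=> /D2[_ <-]; rewrite -derive1E.
split; [move=> x; rewrite in_itv/= => xab|exact: E1|exact: E2].
have [[d1 _] _ c] := gP _ xab; split; [exact: d1|by case: (D2 _ xab)|].
suff : g^`(2)%classic y @[y --> x] --> g2 x by rewrite -(E2 _ xab); exact.
apply: cvg_trans c; apply: near_eq_cvg; near=> y; rewrite E2//.
by near: y; exact: near_itvoo.
Unshelve. all: by end_near. Qed.

(** The scalar mean value theorem for [dot w (f t)], with [w] the chord, followed by
    Cauchy-Schwarz. *)
Lemma enorm_MVT f (f1 : R -> 'rV[R]_n) (c u v : R) : u <= v ->
  (forall x : R, u <= x <= v -> is_derive x 1 f (f1 x)) ->
  (forall x, u <= x <= v -> enorm (f1 x) <= c) ->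
  enorm (f v - f u) <= c * (v - u).
Proof.
move=> uv fd fc; pose w := f v - f u.
have [w0|w0] := eqVneq (enorm w) 0.
  rewrite -/w w0 mulr_ge0 ?subr_ge0//.
  by rewrite (le_trans (enorm_ge0 (f1 u)))// fc// lexx.
have [x xuv E] := MVT_closed (fun t => dot w (f t)) (fun t => dot w (f1 t))
  u v uv (fun z h => is_derive_dotr w f z (f1 z) (fd z h)).
have wp : 0 < enorm w by rewrite lt_neqAle eq_sym w0 enorm_ge0.
rewrite -(ler_pM2l wp) -expr2 sqr_enorm {2}/w dotBr E mulrA.
rewrite ler_wpM2r ?subr_ge0// (le_trans (ler_dot _ _))// ler_wpM2l ?enorm_ge0//.
exact: fc.
Qed.

Lemma evariation_le f (c u v : R) (s : seq R) : path <%R u s -> last u s = v ->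
  (forall x y, u <= x -> x < y -> y <= v -> enorm (f y - f x) <= c * (y - x)) ->
  evariation u v f s <= c * (v - u).
Proof.
elim: s u => [|x s IH] u /=.
  by move=> _ -> _; rewrite /evariation big_nil subrr mulr0.
move=> /andP[ux xs] lv fc.
have xv : x <= v.
  have : itv_partition x v s by split => //; exact/eqP.
  by move/itv_partition_le.
have -> : evariation u v f (x :: s) = enorm (f x - f u) + evariation x v f s.
  by rewrite /evariation /= big_nat_recl.
rewrite (_ : v - u = (x - u) + (v - x)); last by ring.
rewrite mulrDr lerD ?fc// IH// => y z xy yz zv.
by rewrite fc// (le_trans (ltW ux)).
Qed.

(** The one-interval partition bounds each chord by its parameter length, hence the speed by [1]. A
    speed below some [c < 1] near [x] would, by [enorm_MVT], make the variation on a short interval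
    at most [c] times its length. *)
Lemma unit_speed (l : R) f (f1 f2 : R -> 'rV[R]_n) :
  (forall x : R, 0 < x < l -> is_derive x 1 f (f1 x)) ->
  (forall x : R, 0 < x < l -> is_derive x 1 f1 (f2 x)) ->
  arc_length_parametrized l f -> forall x, 0 < x < l -> enorm (f1 x) = 1.
Proof.
move=> fd f1d farc x xl.
have chord u v : 0 < u -> u < v -> v < l -> enorm (f v - f u) <= v - u.
  move=> u0 uv vl; have := farc u v u0 uv vl => E.
  rewrite -lee_fin -E; apply: ereal_sup_ubound.
  exists [:: v]; first exact: itv_partition1.
  by rewrite /evariation big_nat1.
have cf1 : {for x, continuous (fun y => enorm (f1 y))}.
  apply: (@continuous_comp _ _ _ f1 (@enorm R n)); last exact: enorm_continuous.
  exact: is_derive_row_continuous (f1d _ xl).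
apply/eqP; rewrite eq_le; apply/andP; split.
  have [fdx fE] := fd _ xl.
  have cv : enorm (h^-1 *: (f (h *: 1 + x) - f x)) @[h --> 0^'] --> enorm (f1 x).
    apply: cvg_comp; last exact: enorm_continuous.
    by rewrite -fE; exact: fdx.
  apply: (cvgr_to_le cv).
  have nx : \forall h \near (0 : R), 0 < h *: 1 + x < l.
    have : {for (0 : R), continuous (fun h : R => h *: 1 + x)}.
      move=> h; rewrite /continuous_at; apply: cvgD; last exact: cvg_cst.
      by apply: cvgZl; exact: cvg_id.
    rewrite /prop_for /continuous_at scale0r add0r => c.
    exact: (c _ (near_itvoo _ _ _ xl)).
  near=> h.
  have h0 : h != 0 by near: h; exact: nbhs_dnbhs_neq.
  have hl : 0 < h *: 1 + x < l by near: h; exact: nbhs_dnbhs.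
  rewrite enormZ normfV mulrC ler_pdivrMr ?normr_gt0// mul1r.
  move: hl; rewrite [h *: 1]mulr1 => /andP[p1 p2]; move: xl => /andP[x0 xl].
  case: (ltrgt0P h) => hh.
  - by rewrite (le_trans (chord _ _ _ _ _))// ?ltrDr//; lra.
  - rewrite -opprB enormN (le_trans (chord _ _ _ _ _))//; first by lra.
    by rewrite opprD addrCA subrr addr0.
  - by rewrite hh eqxx in h0.
rewrite leNgt; apply/negP => lt1.
pose c := (enorm (f1 x) + 1) / 2.
have c1 : c < 1 by rewrite /c; lra.
have cx : enorm (f1 x) < c by rewrite /c; lra.
have nc : \forall y \near x, enorm (f1 y) < c by exact: (cvgr_lt _ cf1).
have [e /= e0 be] := filterI nc (near_itvoo _ _ _ xl).
have bex y : x <= y <= x + e / 2 -> enorm (f1 y) < c /\ 0 < y < l.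
  move=> /andP[xy ye]; apply: be; rewrite /ball_/= distrC ger0_norm ?subr_ge0//.
  by lra.
have e20 : 0 < e / 2 by rewrite divr_gt0.
have xe : x < x + e / 2 by rewrite ltrDl.
have x0 : 0 < x by case/andP: xl.
have [|_ /andP[_ vl]] := bex (x + e / 2); first by rewrite lexx andbT ltW.
have := farc x (x + e / 2) x0 xe vl => E.
have : (total_evariation x (x + e / 2) f <= (c * (x + e / 2 - x))%:E)%E.
  apply: ge_ereal_sup => _ [s [sp /eqP sl] <-]; rewrite lee_fin.
  apply: evariation_le => // y z xy yz zv.
  apply: (enorm_MVT f f1); first exact: ltW.
  - move=> w /andP[yw wz]; apply: fd.
    by have [|//] := bex w; rewrite (le_trans xy yw) (le_trans wz zv).
  - move=> w /andP[yw wz].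
    by have [|/ltW//] := bex w; rewrite (le_trans xy yw) (le_trans wz zv).
rewrite E lee_fin leNgt => /negP; apply.
by rewrite gtr_pMl// addrC addKr.
Unshelve. all: by end_near. Qed.

End C2_curves.

(** * From subdivisions to parametrizations and back *)

Lemma increasing_homeomorphism {R : realType} (l : R) (H H1 : R -> R) :
  (forall z : R, 0 < z < 1 -> is_derive z 1 H (H1 z)) ->
  (forall z, 0 < z < 1 -> 0 < H1 z /\ 0 < H z < l) ->
  (forall y, 0 < y < l -> exists z z',
     [/\ 0 < z < 1, 0 < z' < 1 & H z < y < H z']) ->
  homeomorphism_between `]0, 1[ `]0, l[ H /\
  (forall x y, 0 < x < 1 -> 0 < y < 1 -> x < y -> H x < H y).
Proof.
move=> Hd Hp Hc.
have Hinc x y : 0 < x < 1 -> 0 < y < 1 -> x < y -> H x < H y.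
  move=> /andP[x0 x1] /andP[y0 y1] xy.
  apply: (lt_derive_gt0 _ H1) => // z /andP[xz zy].
    by apply: Hd; rewrite (lt_le_trans x0 xz) (le_lt_trans zy y1).
  by have [|->] := Hp z; rewrite // (lt_le_trans x0 xz) (le_lt_trans zy y1).
split => //.
have Hinj x y : 0 < x < 1 -> 0 < y < 1 -> H x = H y -> x = y.
  move=> x01 y01 E; case: (ltgtP x y) => // h.
    by have := Hinc _ _ x01 y01 h; rewrite E ltxx.
  by have := Hinc _ _ y01 x01 h; rewrite E ltxx.
have Hsurj y : 0 < y < l -> exists2 z, 0 < z < 1 & H z = y.
  move=> /Hc[u [v [/andP[u0 u1] /andP[v0 v1] /andP[uy yv]]]].
  have uv : u < v.
    rewrite ltNge le_eqVlt; apply/negP => /predU1P[E|vu].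
      by move: (lt_trans uy yv); rewrite E ltxx.
    have := Hinc v u; rewrite v0 v1 u0 u1 => /(_ isT isT vu).
    by rewrite ltNge ltW// (lt_trans uy).
  have cH : {within `[u, v], continuous H}.
    apply: continuous_in_subspaceT => z; rewrite inE/= in_itv/= => /andP[uz zv].
    apply: is_derive_continuous (Hd z _).
    by rewrite (lt_le_trans u0 uz) (le_lt_trans zv v1).
  have [|z] := @IVT _ H u v y (ltW uv) cH.
    rewrite ge_min le_max (ltW uy) (ltW yv) orbT//.
  rewrite in_itv/= => /andP[uz zv] zE; exists z => //.
  by rewrite (lt_le_trans u0 uz) (le_lt_trans zv v1).
pose k y := xget 0 [set z | 0 < z < 1 /\ H z = y].
have Hk x : 0 < x < 1 -> k (H x) = x.
  move=> x01; rewrite /k; case: xgetP => [z _ [z01 zE]|/(_ x)].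
    exact: Hinj.
  by case.
split.
- split.
  + move=> x /=; rewrite !in_itv/= => x01.
    by case: (Hp x x01).
  + move=> x y; rewrite !inE/= !in_itv/=; exact: Hinj.
  + move=> y /=; rewrite in_itv/= => /Hsurj[z z01 zE].
    by exists z => //=; rewrite in_itv.
- apply: continuous_in_subspaceT => z; rewrite inE/= in_itv/= => z01.
  exact: is_derive_continuous (Hd z z01).
exists k; first by move=> x; rewrite inE/= in_itv/=; exact: Hk.
apply: continuous_in_subspaceT => y; rewrite inE/= in_itv/= => /Hsurj[z z01 <-].
have nk : {near H z, continuous k}.
  apply: (@near_can_continuous _ H); near=> w.
    by apply: Hk; near: w; exact: near_itvoo.
  have w01 : 0 < w < 1 by near: w; exact: near_itvoo.
  exact: is_derive_continuous (Hd w w01).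
exact: (nbhs_singleton nk).
Unshelve. all: by end_near. Qed.

(** For [g = f \o H] the chain rule gives [g'' = H'' f' + H'^2 f'']. By unit speed the two summands
    have norms [|H''|] and [H'^2 kappa], each bounded by [C]. *)
Lemma parametrization_of_nodes {R : realType} (n : nat) (l : R)
    (f : R -> 'rV[R]_n) : 0 < l -> C2_on 0 l f ->
  (forall x, 0 < x < l -> enorm (f^`()%classic x) = 1) ->
  node_system (curvature1 f) (l / 2) l ->
  node_system (fun y => curvature1 f (l - y)) (l / 2) l ->
  has_bounded_C2_parametrization l f.
Proof.
move=> l0 fC2 f1 NR NL.
have fd := C2_on_is_derive _ _ _ fC2.
have K0 y : 0 <= curvature1 f y by exact: enorm_ge0.
have [|||H [H1 [H2 [C [Hd Hp Hc]]]]] :=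
  reparametrization_of_nodes (curvature1 f) (l / 2) l K0.
- by apply/andP; split; lra.
- exact: NR.
- by rewrite (_ : l - l / 2 = l / 2)//; lra.
have [|z /Hp[? _ _ ->]|y /Hc//|hom Hinc] := increasing_homeomorphism l H H1.
- by move=> z /Hd[].
- by [].
pose f' := f^`()%classic; pose f'' := f^`(2)%classic.
pose g1 z := H1 z *: f' (H z).
pose g2 z := H2 z *: f' (H z) + H1 z *: (H1 z *: f'' (H z)).
have gd (z : R) : 0 < z < 1 -> [/\ is_derive z 1 (f \o H) (g1 z),
    is_derive z 1 g1 (g2 z) & {for z, continuous g2}].
  move=> z01; have [d1 d2 c] := Hd _ z01; have [_ _ _ Hl] := Hp _ z01.
  have [e1 e2 e3] := fd _ Hl.
  have f'H := is_derive_row_comp _ _ _ _ _ e2 d1.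
  split.
  - exact: is_derive_row_comp e1 d1.
  - exact: (is_derive_row_scale _ _ _ _ _ d2 f'H).
  - have cH1 : {for z, continuous H1} := is_derive_continuous _ _ _ d2.
    have cH : {for z, continuous H} := is_derive_continuous _ _ _ d1.
    have cf' : {for z, continuous (f' \o H)} := is_derive_row_continuous _ _ _ f'H.
    have cf'' : {for z, continuous (f'' \o H)}.
      exact: (@continuous_comp _ _ _ H f'' z cH e3).
    apply: cvgD; first exact: (cvgZ c cf').
    exact: (cvgZ cH1 (cvgZ cH1 cf'')).
have [gC2 gE1 gE2] := C2_on_of_is_derive 0 1 _ _ _ gd.
exists (f \o H); split.
- by exists H; split.
- exact: gC2.
- move=> x; rewrite in_itv/= => x01; rewrite gE1//.
  have [H1x _ _ Hl] := Hp _ x01.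
  rewrite /g1 scaler_eq0 negb_or gt_eqF//=.
  apply/eqP => E; have := f1 _ Hl; rewrite -/f' E.
  rewrite -(scale0r (0 : 'rV[R]_n)) enormZ normr0 mul0r => /esym/eqP.
  by rewrite oner_eq0.
- exists (C + C) => x; rewrite in_itv/= => x01.
  apply: (@le_trans _ _ (enorm (g2 x))); first by rewrite -(gE2 _ x01).
  have [H1x H2x Kx Hl] := Hp _ x01.
  rewrite (le_trans (ler_enormD _ _))// lerD//.
    by rewrite enormZ f1// mulr1.
  by rewrite scalerA -expr2 enormZ ger0_norm// sqr_ge0.
Qed.

(** The norm of Caratheodory's slope function at [x]. Passing to norms turns slopes of curves into
    scalars that can be divided by one another. *)
Definition chord_speed {R : realType} {n : nat} (f : R -> 'rV[R]_n) (x : R)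
    (d : 'rV[R]_n) (y : R) : R :=
  if y == x then enorm d else enorm ((y - x)^-1 *: (f y - f x)).

Lemma chord_speed_continuous {R : realType} {n : nat} (f : R -> 'rV[R]_n)
    (x : R) (d : 'rV[R]_n) :
  is_derive x 1 f d -> {for x, continuous (chord_speed f x d)}.
Proof.
move=> [fx <-]; apply/continuous_withinNshiftx.
have cv : enorm (h^-1 *: (f (h *: 1 + x) - f x)) @[h --> 0^'] --> enorm ('D_1 f x).
  by apply: cvg_comp; [exact: fx|exact: enorm_continuous].
rewrite /chord_speed eqxx; apply: cvg_trans cv; apply: near_eq_cvg.
near=> h; rewrite /= ifF.
  by rewrite addrK [h *: 1]mulr1.
apply/negbTE; rewrite -subr_eq0 addrK.
by near: h; exact: nbhs_dnbhs_neq.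
Unshelve. all: by end_near. Qed.

Lemma is_derive_row_unique {R : realType} {n : nat} (f : R -> 'rV[R]_n) (x : R)
    (a b : 'rV[R]_n) : is_derive x 1 f a -> is_derive x 1 f b -> a = b.
Proof. by move=> [_ <-] [_ <-]. Qed.

(* As [f] has unit speed, the difference quotients of [h] are those of
   [f \o h], in norm, up to a factor that tends to 1. *)
Lemma parameter_is_derive {R : realType} {n : nat} (f g : R -> 'rV[R]_n)
    (h : R -> R) (x : R) (f1 g1 : 'rV[R]_n) :
  {for x, continuous h} -> (\forall y \near x, g y = f (h y)) ->
  (\forall y \near x, (x < y -> h x < h y) /\ (y < x -> h y < h x)) ->
  is_derive (h x) 1 f f1 -> enorm f1 = 1 -> is_derive x 1 g g1 ->
  is_derive x 1 h (enorm g1).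
Proof.
move=> ch gfh hmon fd f1E gd.
pose A := chord_speed g x g1; pose B := chord_speed f (h x) f1.
have cA : {for x, continuous A} by exact: chord_speed_continuous.
have cB : {for h x, continuous B} by exact: chord_speed_continuous.
have cBh : {for x, continuous (B \o h)} by exact: (@continuous_comp _ _ _ h B).
have B1 : (B \o h) x = 1 by rewrite /= /B /chord_speed eqxx.
apply/is_derive1_caratheodory.
exists (fun y => if y == x then enorm g1 else (h y - h x) / (y - x)); split.
- move=> y; have [->|yx] := eqVneq y x; first by rewrite !subrr mulr0.
  by rewrite divfK// subr_eq0.
- have cAB : {for x, continuous (fun y => A y / (B \o h) y)}.
    apply: cvgM; first exact: cA.
    by apply: cvgV; [rewrite B1 oner_eq0|exact: cBh].
  have Ex : A x / (B \o h) x = enorm g1 by rewrite B1 divr1 /A /chord_speed eqxx.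
  rewrite /prop_for /continuous_at eqxx -Ex.
  apply: cvg_trans cAB; apply: near_eq_cvg.
  have Bpos : \forall y \near x, 0 < (B \o h) y.
    by apply: (cvgr_gt _ cBh); rewrite B1.
  near=> y; case: ifPn => [/eqP -> //|yx].
  have gy : g y = f (h y) by near: y.
  have gx : g x = f (h x) by exact: (nbhs_singleton gfh).
  have By : 0 < (B \o h) y by near: y.
  have [m1 m2] : (x < y -> h x < h y) /\ (y < x -> h y < h x) by near: y.
  (* The quotient [A / (B \o h)] determines the slope of [h] only up to sign; monotonicity settles
     the sign. *)
  have pos : 0 < (h y - h x) / (y - x).
    case: (ltgtP x y) yx => // [xy|xy] _.
      by rewrite divr_gt0// subr_gt0// m1.
    by rewrite -mulrNN -invrN !opprB divr_gt0// subr_gt0// m2.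
  have hyx : h y != h x.
    by apply: contraTN pos => /eqP ->; rewrite subrr mul0r ltxx.
  apply: (canLR (mulfK _)); first by rewrite gt_eqF.
  move: By; rewrite /A /= /B /chord_speed (negbTE yx) (negbTE hyx) => _.
  rewrite gy gx -(gtr0_norm pos) -enormZ scalerA mulrAC divff ?mul1r//.
  by rewrite subr_eq0.
- by rewrite eqxx.
Unshelve. all: by end_near. Qed.

(** [h' = |g'|] is differentiable as [g'] has no zero, and [|h''| <= |g''|] by Cauchy-Schwarz.
    Solving [g'' = h'' f' + h'^2 f''] for the last term bounds [h'^2 kappa] by [2 M0]; the [+ 1] in
    the final bound makes it positive. *)
Lemma speed_of_parametrization {R : realType} (n : nat) (l : R)
    (f : R -> 'rV[R]_n) : C2_on 0 l f ->
  (forall x, 0 < x < l -> enorm (f^`()%classic x) = 1) ->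
  has_bounded_C2_parametrization l f ->
  exists (h h1 h2 : R -> R) (M : R), [/\ 0 < M,
    forall x : R, 0 < x < 1 -> is_derive x 1 h (h1 x) /\ is_derive x 1 h1 (h2 x),
    forall x, 0 < x < 1 -> [/\ 0 < h1 x, 0 < h x < l, `|h2 x| <= M &
      h1 x ^+ 2 * curvature1 f (h x) <= M] &
    forall y, 0 < y < l -> exists2 x, 0 < x < 1 & h x = y].
Proof.
move=> fC2 f1 [g [[h [[[hA hinj hsurj] hc _] hmon gfh]] gC2 g1n0 [M0 gM]]].
have fd := C2_on_is_derive _ _ _ fC2.
have gd := C2_on_is_derive _ _ _ gC2.
pose f' := f^`()%classic; pose f'' := f^`(2)%classic.
pose g' := g^`()%classic; pose g'' := g^`(2)%classic.
have {}hA x : 0 < x < 1 -> 0 < h x < l.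
  by move=> x01; have := hA x; rewrite /= !in_itv/=; exact.
have {}hmon x y : 0 < x < 1 -> 0 < y < 1 -> x < y -> h x < h y.
  by move=> x01 y01; apply: hmon => //; rewrite ?inE/= in_itv.
have {}gfh x : 0 < x < 1 -> g x = f (h x).
  by move=> x01; apply: gfh; rewrite in_itv.
have {}hc x : 0 < x < 1 -> {for x, continuous h}.
  move: hc; rewrite continuous_open_subspace; last exact: itv_open.
  by move=> hc x01; apply: hc; rewrite inE/= in_itv.
have {}g1n0 x : 0 < x < 1 -> g' x != 0.
  by move=> x01; apply: g1n0; rewrite in_itv.
have {}gM x : 0 < x < 1 -> enorm (g'' x) <= M0.
  by move=> x01; apply: gM; rewrite in_itv.
pose h1 x := enorm (g' x).
pose h2 x := dot (g' x) (g'' x) / enorm (g' x).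
have hd (x : R) : 0 < x < 1 -> is_derive x 1 h (h1 x).
  move=> x01; have [gx _ _] := gd x x01.
  have [fx _ _] := fd _ (hA _ x01).
  apply: (parameter_is_derive f g h x (f' (h x))) => //.
  - exact: hc.
  - near=> y; apply: gfh; near: y; exact: near_itvoo.
  - near=> y.
    have y01 : 0 < y < 1 by near: y; exact: near_itvoo.
    by split; exact: hmon.
  - by apply: f1; exact: hA.
have h1d (x : R) : 0 < x < 1 -> is_derive x 1 h1 (h2 x).
  move=> x01; have [_ gx _] := gd x x01.
  exact: is_derive_enorm (g1n0 _ x01) gx.
have g1E (x : R) : 0 < x < 1 -> g' x = h1 x *: f' (h x).
  move=> x01; have [gx _ _] := gd x x01; have [fx _ _] := fd _ (hA _ x01).
  apply: (is_derive_row_unique _ _ _ _ gx).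
  apply: near_eq_is_derive (is_derive_row_comp _ _ _ _ _ fx (hd _ x01)).
  near=> y; rewrite /= gfh//; near: y; exact: near_itvoo.
have g2E (x : R) : 0 < x < 1 -> g'' x = h2 x *: f' (h x) + h1 x *: (h1 x *: f'' (h x)).
  move=> x01; have [_ gx _] := gd x x01; have [_ fx _] := fd _ (hA _ x01).
  apply: (is_derive_row_unique _ _ _ _ gx).
  apply: near_eq_is_derive (is_derive_row_scale _ _ _ _ _ (h1d _ x01)
    (is_derive_row_comp _ _ _ _ _ fx (hd _ x01))).
  near=> y; rewrite -/g' g1E//; near: y; exact: near_itvoo.
have h1p x : 0 < x < 1 -> 0 < h1 x by move=> x01; rewrite enorm_gt0// g1n0.
have h2M x : 0 < x < 1 -> `|h2 x| <= M0.
  move=> x01; rewrite normrM normfV (ger0_norm (enorm_ge0 _)).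
  rewrite ler_pdivrMr; last exact: h1p.
  apply: (le_trans (ler_norm_dot _ _)); rewrite mulrC.
  by apply: ler_wpM2r; [exact: enorm_ge0|exact: gM].
have half01 : 0 < (2^-1 : R) < 1 by rewrite invr_gt0 invf_lt1 ?ltr1n ?ltr0n.
have M00 : 0 <= M0 by exact: le_trans (enorm_ge0 _) (gM _ half01).
exists h, h1, h2, (M0 + M0 + 1); split.
- by rewrite ltr_wpDl// addr_ge0.
- by move=> x x01; split; [exact: hd|exact: h1d].
- move=> x x01; split; [exact: h1p|exact: hA| |].
    by rewrite (le_trans (h2M x x01))// -addrA lerDl addr_ge0.
  have -> : h1 x ^+ 2 * curvature1 f (h x) = enorm (g'' x - h2 x *: f' (h x)).
    rewrite g2E// addrC addKr scalerA -expr2 enormZ ger0_norm ?sqr_ge0//.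
  apply: (le_trans (ler_enormD _ _)).
  rewrite enormN enormZ (f1 _ (hA _ x01)) mulr1 -[leLHS]addr0.
  by apply: lerD; [apply: lerD; [exact: gM|exact: h2M]|exact: ler01].
- move=> y yl; have [|x /= x01 <-] := hsurj y; first by rewrite /= in_itv.
  by exists x => //; move: x01; rewrite in_itv.
Unshelve. all: by end_near. Qed.

Lemma sum_disjoint_itv {R : realType} (m : nat) (c d : 'I_m -> R) :
  (forall k, 0 < c k /\ c k < d k < 1) ->
  trivIset setT (fun k => `]c k, d k[%classic) ->
  \sum_(k < m) (d k - c k) <= 1.
Proof.
move=> cd tri; rewrite -lee_fin -sumEFin.
have -> : (\sum_(k < m) (d k - c k)%:E =
    \sum_(k < m) lebesgue_measure (`]c k, d k[%classic : set R))%E.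
  apply: eq_bigr => k _; have [_ /andP[cdk _]] := cd k.
  by rewrite lebesgue_measure_itv/= lte_fin cdk.
have mU : measurable (\big[setU/set0]_(k < m) `]c k, d k[%classic).
  by apply: bigsetU_measurable => k _; exact: measurable_itv.
have E := @measure_semi_additive_ord _ (measurableTypeR R) R lebesgue_measure m
  (fun k => `]c k, d k[%classic) (fun k => measurable_itv _) tri mU.
rewrite -E.
have -> : 1%:E = lebesgue_measure (`]0%R, 1%R[%classic : set R).
  by rewrite lebesgue_measure_itv/= lte_fin ltr01 -[RHS]/(1 - 0)%:E subr0.
apply: (@le_measure _ R (measurableTypeR R) lebesgue_measure);
  rewrite ?inE//.
apply: (big_ind (fun A => A `<=` `]0, 1[%classic)) => // [A B|k _ z].
  by rewrite subUset.
rewrite /= !in_itv/= => /andP[cz zd].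
have [c0 /andP[_ d1]] := cd k.
by rewrite (lt_trans c0 cz) (lt_trans zd d1).
Qed.

(** * Conditions (ii) and (iii) from a bounded reparametrization *)

Section bounded_reparametrization.
Context {R : realType} (K : R -> R) (l : R) (h h1 h2 : R -> R) (M : R).
Context (M_gt0 : 0 < M)
  (hd : forall x : R, 0 < x < 1 -> is_derive x 1 h (h1 x) /\ is_derive x 1 h1 (h2 x))
  (hP : forall x : R, 0 < x < 1 -> [/\ 0 < h1 x, 0 < h x < l, `|h2 x| <= M &
     h1 x ^+ 2 * K (h x) <= M])
  (hsurj : forall y : R, 0 < y < l -> exists2 x : R, 0 < x < 1 & h x = y).

Lemma reparam_lt x y : 0 < x < 1 -> 0 < y < 1 -> x < y -> h x < h y.
Proof.
move=> /andP[x0 x1] /andP[y0 y1] xy.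
apply: (lt_derive_gt0 _ h1) => // z /andP[xz zy].
  by have [|//] := hd z; rewrite (lt_le_trans x0 xz) (le_lt_trans zy y1).
by have [|->] := hP z; rewrite // (lt_le_trans x0 xz) (le_lt_trans zy y1).
Qed.

Lemma reparam_ltE x y : 0 < x < 1 -> 0 < y < 1 -> (h x < h y) = (x < y).
Proof.
move=> x01 y01; apply/idP/idP => [hxy|]; last exact: reparam_lt.
rewrite ltNge le_eqVlt; apply/negP => /predU1P[E|yx].
  by move: hxy; rewrite E ltxx.
by move: (lt_trans hxy (reparam_lt _ _ y01 x01 yx)); rewrite ltxx.
Qed.

Lemma reparam_leE x y : 0 < x < 1 -> 0 < y < 1 -> (h x <= h y) = (x <= y).
Proof. by move=> x01 y01; rewrite !leNgt reparam_ltE. Qed.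

(** The bound on [h''] makes the speed Lipschitz with constant [M]. *)
Lemma speed_le c d x y : 0 < c -> d < 1 -> c <= x <= d -> c <= y <= d ->
  h1 y <= h1 x + M * (d - c).
Proof.
move=> c0 d1 /andP[cx xd] /andP[cy yd].
have in01 z : c <= z <= d -> 0 < z < 1.
  by move=> /andP[cz zd]; rewrite (lt_le_trans c0 cz) (le_lt_trans zd d1).
have lip u v : c <= u -> u <= v -> v <= d -> `|h1 v - h1 u| <= M * (v - u).
  move=> cu uv vd.
  have [z /andP[uz zv]|z /andP[uz zv] ->] := MVT_closed h1 h2 u v uv.
    by have [|//] := hd z; apply: in01; rewrite (le_trans cu uz) (le_trans zv vd).
  have [|_ _ h2M _] := hP z.
    by apply: in01; rewrite (le_trans cu uz) (le_trans zv vd).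
  rewrite normrM (@ger0_norm _ (v - u)) ?subr_ge0//.
  by apply: ler_wpM2r; rewrite ?subr_ge0.
have Mcd u v : c <= u -> v <= d -> M * (v - u) <= M * (d - c).
  by move=> cu vd; rewrite ler_wpM2l ?(ltW M_gt0)// lerB.
have [xy|/ltW yx] := leP x y.
  have := lip x y cx xy yd; have := Mcd x y cx yd.
  by rewrite ler_norml => ? /andP[? ?]; lra.
have := lip y x cy yx xd; have := Mcd y x cy xd.
by rewrite ler_norml => ? /andP[? ?]; lra.
Qed.

(** With [r = h d - h c], [t = d - c] and [p = h1 x], large curvature at [x] forces a low speed
    there, [delta p^2 <= M r], while the Lipschitz bound gives [r <= (p + M t) t]. The term [p t] is
    absorbed into [r] by AM-GM. *)
Lemma sqrt_length_le delta c d x : 0 < delta -> 0 < c -> d < 1 ->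
  c <= x <= d -> delta <= (h d - h c) * K (h x) ->
  Num.sqrt (h d - h c) <= Num.sqrt (2 * (M + M / delta)) * (d - c).
Proof.
move=> delta0 c0 d1 xcd dK; have /andP[cx xd] := xcd.
have cd : c <= d by exact: le_trans xd.
have in01 z : c <= z <= d -> 0 < z < 1.
  by move=> /andP[cz zd]; rewrite (lt_le_trans c0 cz) (le_lt_trans zd d1).
set C := 2 * (M + M / delta).
have C0 : 0 <= C by rewrite mulr_ge0// addr_ge0 ?divr_ge0// ltW.
have t0 : 0 <= d - c by rewrite subr_ge0.
rewrite -(ger0_norm t0) -sqrtr_sqr -sqrtrM// ler_wsqrtr//.
have [z zcd|z zcd E] := MVT_closed h h1 c d cd.
  by have [|//] := hd z; apply: in01.
have [h1z _ _ _] := hP _ (in01 _ zcd).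
have [h1x _ _ Kx] := hP _ (in01 _ xcd).
have hz := speed_le _ _ _ _ c0 d1 xcd zcd.
have r0 : 0 <= h d - h c by rewrite E mulr_ge0// ltW.
have p2 : delta * h1 x ^+ 2 <= (h d - h c) * M.
  apply: (@le_trans _ _ ((h d - h c) * K (h x) * h1 x ^+ 2)).
    by rewrite ler_wpM2r// sqr_ge0.
  by rewrite -mulrA ler_wpM2l// mulrC.
have r1 : h d - h c <= (h1 x + M * (d - c)) * (d - c).
  by rewrite E ler_wpM2r.
(* AM-GM: [2 t p <= delta p^2 / (2 M) + 2 M t^2 / delta] with [p = h1 x] and
   [t = d - c]. *)
have amgm : 2 * (h1 x * (d - c)) <=
    delta * h1 x ^+ 2 / (2 * M) + 2 * M * (d - c) ^+ 2 / delta.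
  rewrite -subr_ge0.
  have -> : delta * h1 x ^+ 2 / (2 * M) + 2 * M * (d - c) ^+ 2 / delta
      - 2 * (h1 x * (d - c)) =
      (delta * h1 x - 2 * M * (d - c)) ^+ 2 / (2 * M * delta).
    by field; rewrite !gt_eqF.
  by rewrite divr_ge0 ?sqr_ge0// mulr_ge0 ?ltW// mulr_gt0.
have p3 : delta * h1 x ^+ 2 / (2 * M) <= (h d - h c) / 2.
  rewrite ler_pdivrMr ?mulr_gt0//.
  by rewrite (_ : _ / 2 * _ = (h d - h c) * M)//; field.
have -> : C * (d - c) ^+ 2 = 2 * (M * (d - c) * (d - c)) + 2 * M * (d - c) ^+ 2 / delta.
  by rewrite /C; field; rewrite gt_eqF.
(* Twice [r1], with [amgm] and [p3], leaves [3 / 2] of [h d - h c] below the right-hand side. *)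
by lra.
Qed.

(** Preimages of non-overlapping intervals do not overlap in []0, 1[], so their lengths add up to at
    most [1], and the constant of [sqrt_length_le] bounds the whole sum. *)
Lemma sum_sqrt_length_le (n : nat) (f : R -> 'rV[R]_n) delta :
  0 < delta -> K = curvature1 f ->
  (Vdelta l f delta <= (Num.sqrt (2 * (M + M / delta)))%:E)%E.
Proof.
move=> delta0 KE; apply: ge_ereal_sup => _ [m [a [b [[ab tri mx] ->]]]].
rewrite lee_fin.
have abl k : [/\ a k < b k, 0 < a k < l & 0 < b k < l].
  have [akb sub] := ab k; split => //.
    by have := sub (a k); rewrite /= !in_itv/= lexx ltW//; exact.
  by have := sub (b k); rewrite /= !in_itv/= lexx ltW//; exact.
have /choice[c cP] k : exists x, 0 < x < 1 /\ h x = a k.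
  by have [_ /hsurj[x x01 xE] _] := abl k; exists x.
have /choice[d dP] k : exists x, 0 < x < 1 /\ h x = b k.
  by have [_ _ /hsurj[x x01 xE]] := abl k; exists x.
have cd k : c k < d k.
  have [c01 cE] := cP k; have [d01 dE] := dP k.
  by rewrite -reparam_ltE// cE dE; case: (abl k).
apply: (@le_trans _ _ (\sum_(k < m) Num.sqrt (2 * (M + M / delta)) * (d k - c k))).
  apply: ler_sum => k _; have [akb _ bkl] := abl k.
  rewrite (leb_length_itv _ _ (ltW akb)).
  have [_ [[y yab <-] _] dK] := mx k.
  have [c01 cE] := cP k; have [d01 dE] := dP k.
  move: yab; rewrite /= in_itv/= => /andP[ay yb].
  have yl : 0 < y < l.
    have [_ /andP[a0 _] /andP[_ bl]] := abl k.
    by rewrite (lt_le_trans a0 ay) (le_lt_trans yb bl).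
  have [x x01 xE] := hsurj y yl.
  rewrite -cE -dE; apply: (sqrt_length_le delta _ _ x) => //.
  - by case/andP: c01.
  - by case/andP: d01.
  - by rewrite -(reparam_leE _ _ c01 x01) -(reparam_leE _ _ x01 d01) cE dE xE ay.
  - by move: dK; rewrite (leb_length_itv _ _ (ltW akb)) KE xE cE dE.
rewrite -mulr_sumr ler_piMr ?sqrtr_ge0//; apply: sum_disjoint_itv.
  move=> k; have [/andP[c0 _] _] := cP k; have [/andP[_ d1] _] := dP k.
  by rewrite c0 cd d1.
apply/trivIsetP => i j _ _ ij; rewrite -subset0 => z [] /=; rewrite !in_itv/=.
move=> /andP[ciz zdi] /andP[cjz zdj].
have [ci01 ciE] := cP i; have [cj01 cjE] := cP j.
have [di01 diE] := dP i; have [dj01 djE] := dP j.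
have z01 : 0 < z < 1.
  case/andP: ci01 => c0 _; case/andP: di01 => _ d1.
  by rewrite (lt_trans c0 ciz) (lt_trans zdi d1).
move/trivIsetP : tri => /(_ i j I I ij); rewrite !interior_itv -subset0.
move=> /(_ (h z)); apply; split.
  by rewrite /= in_itv/= -ciE -diE !reparam_ltE// ciz.
by rewrite /= in_itv/= -cjE -djE !reparam_ltE// cjz.
Qed.

(** Substituting [s = h x] turns the integral over [[h c, h d]] into that of
    [sqrt (K (h x)) h1 x <= sqrt M] over [[c, d]], of length below [1]. Compact subintervals supply
    the regularity at the end points that the substitution rule asks for. *)
Lemma integral_sqrt_lty : 0 < l -> (forall y, 0 <= K y) ->
  (forall y, 0 < y < l -> {for y, continuous K}) ->
  (\int[lebesgue_measure]_(s in `]0%R, l[) (Num.sqrt (K s))%:E < +oo)%E.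
Proof.
move=> l0 K0 cK.
apply: (integral_itvoo_lty (fun s => Num.sqrt (K s)) l (Num.sqrt M)) => //.
  exact: measurable_sqrt_comp.
move=> u v u0 uv vl.
have [|c c01 cE] := hsurj u; first by rewrite u0 (lt_trans uv).
have [|d d01 dE] := hsurj v; first by rewrite vl (lt_trans u0).
have cd : c < d by rewrite -reparam_ltE// cE dE.
have in01 z : c <= z <= d -> 0 < z < 1.
  move=> /andP[cz zd]; case/andP: c01 => c0 _; case/andP: d01 => _ d1.
  by rewrite (lt_le_trans c0 cz) (le_lt_trans zd d1).
have in01o z : c < z < d -> 0 < z < 1.
  by move=> /andP[? ?]; apply: in01; rewrite !ltW.
have hE z : 0 < z < 1 -> h^`()%classic z = h1 z.
  by move=> /hd[[_ <-] _]; rewrite -derive1E.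
have ch1 z : 0 < z < 1 -> {for z, continuous h1}.
  by move=> /hd[_ D]; exact: is_derive_continuous D.
have ch z : 0 < z < 1 -> {for z, continuous h}.
  by move=> /hd[D _]; exact: is_derive_continuous D.
have near01 (z : R) : 0 < z < 1 -> \forall y \near z, h1 y = h^`()%classic y.
  move=> z01; near=> y; rewrite hE//; near: y; exact: near_itvoo.
have cE1 (z : R) : 0 < z < 1 -> h^`()%classic y @[y --> z] --> h1 z.
  move=> z01; apply: cvg_trans (ch1 z z01).
  by apply: near_eq_cvg; exact: near01.
have ccd : 0 < c < 1 by [].
rewrite -cE -dE.
have S1 : {in `[c, d]%R &, {homo h : x y / x < y}}.
  by move=> x y; rewrite !in_itv/= => xcd ycd; apply: reparam_lt; exact: in01.
have S2 : {in `]c, d[%R, continuous h^`()%classic}.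
  move=> z; rewrite in_itv/= => /in01o z01; rewrite /continuous_at hE//.
  exact: cE1.
have S3 : cvg (h^`()%classic x @[x --> c^'+]).
  by apply/cvg_ex; exists (h1 c); apply: cvg_at_right_filter; exact: cE1.
have S4 : cvg (h^`()%classic x @[x --> d^'-]).
  by apply/cvg_ex; exists (h1 d); apply: cvg_at_left_filter; exact: cE1.
have S5 : derivable_oo_LRcontinuous h c d.
  split.
  - by move=> z; rewrite in_itv/= => /in01o/hd[[]].
  - by apply: cvg_at_right_filter; exact: ch.
  - by apply: cvg_at_left_filter; exact: ch.
have S6 : {within `[h c, h d], continuous (fun s => Num.sqrt (K s))}.
  apply: continuous_in_subspaceT => y.
  rewrite inE/= in_itv/= cE dE => /andP[uy yv].
  apply: (@continuous_comp _ _ _ K Num.sqrt); last exact: sqrt_continuous.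
  by apply: cK; rewrite (lt_le_trans u0 uy) (le_lt_trans yv vl).
rewrite (integration_by_substitution_increasing (ltW cd) S1 S2 S3 S4 S5 S6).
have -> : (\int[lebesgue_measure]_(x in `[c, d])
    ((((fun s : R => Num.sqrt (K s)) \o h) * h^`()%classic) x)%:E =
    \int[lebesgue_measure]_(x in `[c, d]) (Num.sqrt (K (h x)) * h1 x)%:E)%E.
  apply: eq_integral => x; rewrite inE/= in_itv/= => /in01 x01.
  by congr EFin; rewrite -hE.
apply: (@le_trans _ _ (\int[lebesgue_measure]_(x in `[c, d])
    (cst (Num.sqrt M)%:E) x)%E).
  apply: ge0_le_integral => //=.
  - move=> x; rewrite in_itv/= => /in01/hP[/ltW h1x _ _ _].
    by rewrite lee_fin mulr_ge0// sqrtr_ge0.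
  - apply/measurable_EFinP; apply: subspace_continuous_measurable_fun => //.
    apply: continuous_in_subspaceT => x; rewrite inE/= in_itv/= => /in01 x01.
    apply: (@cvgM _ _ _ _ (fun x => Num.sqrt (K (h x))) h1); last exact: ch1.
    apply: (@continuous_comp _ _ _ h (fun s => Num.sqrt (K s))); first exact: ch.
    apply: (@continuous_comp _ _ _ K Num.sqrt); last exact: sqrt_continuous.
    by apply: cK; case: (hP _ x01).
  - move=> x; rewrite in_itv/= => /in01/hP[/ltW h1x _ _ KM].
    rewrite lee_fin -{1}(ger0_norm h1x) -sqrtr_sqr -sqrtrM// ler_wsqrtr//.
    by rewrite mulrC.
rewrite integral_cst//= lebesgue_measure_itv/= lte_fin cd -EFinB -EFinM lee_fin.
rewrite ler_piMr ?sqrtr_ge0//.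
by case/andP: c01 => c0 _; case/andP: d01 => _ d1; lra.
Unshelve. all: by end_near. Qed.

End bounded_reparametrization.

(** * Assembling the equivalences *)

Lemma monotone_on_reflect {R : realType} (K : R -> R) (l e : R) :
  monotone_on `]0, e[ K -> monotone_on `]l - e, l[ (fun y => K (l - y)).
Proof.
have refl y : y \in (`]l - e, l[%classic : set R) ->
    l - y \in (`]0, e[%classic : set R).
  by rewrite !inE/= !in_itv/= => /andP[? ?]; apply/andP; split; lra.
move=> [Kmon|Kmon]; [right|left] => x y /refl xe /refl ye xy.
- by apply: Kmon => //; rewrite lerD2l lerN2.
- by apply: Kmon => //; rewrite lerD2l lerN2.
Qed.

Theorem proposition4p9 (R : realType) (n : nat) (l : R) (f : R -> 'rV[R]_n)
    (delta : R) (l_gt0 : 0 < l) (f_C2 : C2_on 0 l f)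
    (f_arc : arc_length_parametrized l f) (delta_gt0 : 0 < delta) :
  let c1 := has_bounded_C2_parametrization l f in
  let c2 := (Vdelta l f delta < +oo)%E in
  let c3 := (\int[lebesgue_measure]_(s in `]0%R, l[)
               (Num.sqrt (curvature1 f s))%:E < +oo)%E in
  [/\ c1 <-> c2, c1 -> c3 &
      monotone_near_ends l (curvature1 f) ->
      [/\ c1 <-> c2, c1 <-> c3 & c2 <-> c3]].
Proof.
move=> c1 c2 c3.
have fd := C2_on_is_derive _ _ _ f_C2.
have speed1 x : 0 < x < l -> enorm (f^`()%classic x) = 1.
  by apply: (unit_speed l f _ f^`(2)%classic) f_arc _ => y /fd[].
have K0 y : 0 <= curvature1 f y by exact: enorm_ge0.
have cK y : 0 < y < l -> {for y, continuous (curvature1 f)}.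
  move=> /fd[_ _ cf2].
  apply: (@continuous_comp _ _ _ f^`(2)%classic (@enorm R n)); first exact: cf2.
  exact: enorm_continuous.
have K0' y : 0 <= curvature1 f (l - y) by [].
have cK' y : 0 < y < l -> {for y, continuous (fun y => curvature1 f (l - y))}.
  move=> /andP[y0 yl].
  have -> : (fun y => curvature1 f (l - y)) = (fun y => curvature1 f (l + (-1) * y)).
    by apply/funext => z; rewrite mulN1r.
  by apply: continuous_comp_affine; apply: cK; apply/andP; split; lra.
(* Both walks start at the midpoint, the fixed point of the reflection [y -> l - y]. *)
have half : 0 < l / 2 < l by apply/andP; split; lra.
have c12 : c1 -> c2.
  move=> /(speed_of_parametrization _ _ _ f_C2 speed1)[h [h1 [h2 [M [M0 hd hP hs]]]]].
  apply: le_lt_trans (ltry (Num.sqrt (2 * (M + M / delta)))).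
  exact: (sum_sqrt_length_le (curvature1 f) l h h1 h2).
have c13 : c1 -> c3.
  move=> /(speed_of_parametrization _ _ _ f_C2 speed1)[h [h1 [h2 [M [M0 hd hP hs]]]]].
  exact: (integral_sqrt_lty (curvature1 f) l h h1 h2 M).
have c21 : c2 -> c1.
  move=> /Vdelta_sum_bound[V VP].
  apply: parametrization_of_nodes => //.
    exact: (node_system_of_sum_bound _ _ _ delta V).
  exact: (node_system_of_sum_bound _ _ _ _ _ half delta_gt0 K0' cK'
    (separated_sum_bound_reflect _ _ _ _ VP)).
have c31 : monotone_near_ends l (curvature1 f) -> c3 -> c1.
  move=> [[e /andP[e0 el] emon] [e' /andP[e'0 e'l] e'mon]].
  move=> /(integrable_sqrt_integral_bound _ _ cK) bnd.
  apply: parametrization_of_nodes => //.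
    exact: (node_system_of_monotone _ _ e').
  have le : l - e < l by rewrite gtrBl.
  exact: (node_system_of_monotone _ _ _ _ half le K0' cK'
    (sqrt_integral_bound_reflect _ _ bnd) (monotone_on_reflect _ _ _ emon)).
split; [by split|by []|].
move=> mon; split; split => //.
- exact: c31.
- by move=> /c21/c13.
- by move=> /(c31 mon)/c12.
Qed.
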